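(* Let $\mathcal D\subset\mathbb C^2$ be an irreducible affine plane curve which is not a line, let $G(y_1,y_2,y_3)$ be the form defining its projective closure $\overline{\mathcal D}\subset\mathbb P^2$, and let $Z(\bar y_H,\bar u)\in\mathbb C[y_1,y_2,y_3,u_1,u_2]$ be homogeneous in $\bar y_H=(y_1,y_2,y_3)$ and depend on $y_3$. Suppose there is a non-empty Zariski open set $\Xi\subset\mathbb C^2$ such that for every $\bar\omega\in\Xi$: (1) $\deg_{\bar y_H}Z(\bar y_H,\bar\omega)=\deg_{\bar y_H}Z(\bar y_H,\bar u)$ (in particular $Z(\bar y_H,\bar\omega)$ is non-constant); let $\overline{\mathcal Z(\bar\omega)}\subset\mathbb P^2$ be the curve it defines; (2) $\overline{\mathcal Z(\bar\omega)}$ and $\overline{\mathcal D}$ have no common component; (3) setting $\mathcal G=\bigcap_{\bar u\in\Xi}\big(\overline{\mathcal Z(\bar u)}\cap\overline{\mathcal D}\big)$, for every $p\in(\overline{\mathcal Z(\bar\omega)}\cap\overline{\mathcal D})\setminus\mathcal G$ one has $\operatorname{mult}_p(\overline{\mathcal D},\overline{\mathcal Z(\bar\omega)})=1$; (4) writing $Z(\bar y_H,\bar u)=\sum_\alpha Z_\alpha(\bar y_H)\bar u^\alpha$ with $Z_\alpha\in\mathbb C[\bar y_H]$, and letting $\mathcal J_\alpha\subset\mathbb P^2$ be the zero set of $Z_\alpha$, one has $\bigcap_\alpha(\overline{\mathcal D}\cap\mathcal J_\alpha)\subset\mathcal G$; (5) $(0:0:1)\notin(\overline{\mathcal Z(\bar\omega)}\cap\overline{\mathcal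 D})\setminus\mathcal G$. Then there exists a non-empty Zariski open subset $\Xi^\star\subset\Xi$ such that for every $\bar\omega\in\Xi^\star$, $$\operatorname{Card}\big((\overline{\mathcal Z(\bar\omega)}\cap\overline{\mathcal D})\setminus\mathcal G\big)=\deg_{\{y_1,y_2\}}\Big(\operatorname{PP}_{\bar u}\big(\operatorname{Res}_{y_3}(G(\bar y_H),Z(\bar y_H,\bar u))\big)\Big).$$
   Context: $\bar u=(u_1,u_2)$. For $h\in\mathbb C[y_1,y_2,y_3,\bar u]$, $\operatorname{PP}_{\bar u}(h)$ denotes the primitive part of $h$ with respect to $\bar u$ (i.e. $h$ divided by its content, the gcd of its coefficients as a polynomial in $\bar u$ over $\mathbb C[y_1,y_2,y_3]$), and $\operatorname{Res}_{y_3}(h_1,h_2)$ is the resultant with respect to $y_3$. $\deg_{\{y_1,y_2\}}$ is the total degree in $y_1,y_2$. $\operatorname{mult}_p$ denotes intersection multiplicity of projective plane curves at $p$. *)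

(* Defs.v *)
From HB Require Import structures.
From mathcomp Require Import all_boot all_order all_algebra.
From mathcomp Require Import complex.
From mathcomp Require Import Rstruct.
From mathcomp.multinomials Require Import mpoly.
From Stdlib Require Rdefinitions.
Set Implicit Arguments. Unset Strict Implicit. Unset Printing Implicit Defensive.
Import GRing.Theory.
Import ComplexField.
Local Open Scope ring_scope.

Definition C : numClosedFieldType := complex Rdefinitions.R.

Definition mdvd (n : nat) (a b : {mpoly C[n]}) : Prop := exists q, b = q * a.

Definition mirreducible (n : nat) (p : {mpoly C[n]}) : Prop :=
  (1 < msize p)%N /\
  forall a b : {mpoly C[n]}, p = a * b -> msize a = 1%N \/ msize b = 1%N.

Definition homogenize (g : {mpoly C[2]}) : {mpoly C[3]} :=
  \sum_(m <- msupp g)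
     (g@_m *: ('X_(inord 0) ^+ (m (inord 0)) * 'X_(inord 1) ^+ (m (inord 1))
               * 'X_(inord 2) ^+ ((msize g).-1 - mdeg m)%N)).

Definition common_component (F H : {mpoly C[3]}) : Prop :=
  exists c : {mpoly C[3]}, (1 < msize c)%N /\ mdvd c F /\ mdvd c H.

(* A point of P^2 is represented by its unique normalized representative:
   the first nonzero homogeneous coordinate equals 1. *)
Definition pt := 'I_3 -> C.

Definition chart (p : pt) : 'I_3 :=
  if p (inord 0) != 0 then inord 0 else if p (inord 1) != 0 then inord 1 else inord 2.

Definition normalized (p : pt) : Prop := p (chart p) = 1.

Definition pt001 : pt := fun i => if i == inord 2 then 1 else 0.

Definition on_curve (F : {mpoly C[3]}) (p : pt) : Prop := F.@[p] = 0.

(* Intersection multiplicity: mult_p(F,H) = dim_C O_p / (f, h), where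
   O_p is the local ring of P^2 at p.  Working in the affine chart y_i = 1
   (i = chart p), O_p/(f,h)O_p is computed as C[y1,y2,y3]/J_p with
   J_p = { h | exists s, s(p) <> 0, s*h in (F, H, y_i - 1) }. *)
Definition loc_ideal (F H : {mpoly C[3]}) (p : pt) (h : {mpoly C[3]}) : Prop :=
  exists s a b c : {mpoly C[3]},
    s.@[p] != 0 /\ s * h = a * F + b * H + c * ('X_(chart p) - 1).

Definition imult_eq (F H : {mpoly C[3]}) (p : pt) (n : nat) : Prop :=
  exists bs : 'I_n -> {mpoly C[3]},
    (forall h, exists lam : 'I_n -> C,
        loc_ideal F H p (h - \sum_(k < n) lam k *: bs k)) /\
    (forall lam : 'I_n -> C,
        loc_ideal F H p (\sum_(k < n) lam k *: bs k) -> forall k, lam k = 0).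

(* cardinality of a set of points of P^2 (given on normalized representatives) *)
Definition card_is (S : pt -> Prop) (n : nat) : Prop :=
  exists f : 'I_n -> pt,
    injective f /\ (forall k, S (f k)) /\ (forall p, S p -> exists k, f k = p).

Definition zopen (U : ('I_2 -> C) -> Prop) : Prop :=
  exists s : seq {mpoly C[2]}, forall w, U w <-> has (fun f => f.@[w] != 0) s.

(* Z(y,u) is an element of C[y1,y2,y3][u1,u2]; its coefficients Z_alpha
   are Z@_alpha.  Specialization u := w : *)
Definition specialize (Z : {mpoly {mpoly C[3]}[2]}) (w : 'I_2 -> C) : {mpoly C[3]} :=
  Z.@[fun j => (w j)%:MP_[3]].

Definition ydeg3 (Z : {mpoly {mpoly C[3]}[2]}) : nat :=
  \max_(m <- msupp Z) (msize Z@_m).-1.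

(* A := C[y1,y2][u1,u2]; resultants w.r.t. y3 live in A. *)
Definition A := {mpoly {mpoly C[2]}[2]}.

Definition toY3 (p : {mpoly C[3]}) : {poly A} :=
  mmap (fun c : C => ((c%:MP_[2])%:MP_[2] : A)%:P)
       (fun i : 'I_3 => if i == inord 2 then 'X
                        else ((('X_(inord i) : {mpoly C[2]})%:MP_[2]) : A)%:P) p.

Definition toY3u (Z : {mpoly {mpoly C[3]}[2]}) : {poly A} :=
  mmap toY3 (fun j : 'I_2 => ('X_j : A)%:P) Z.

Definition res_y3 (G : {mpoly C[3]}) (Z : {mpoly {mpoly C[3]}[2]}) : A :=
  resultant (toY3 G) (toY3u Z).

Definition is_content (c : {mpoly C[2]}) (R : A) : Prop :=
  (forall m, mdvd c R@_m) /\
  (forall d, (forall m, mdvd d R@_m) -> mdvd d c).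

Definition ydeg (h : A) : nat := \max_(m <- msupp h) (msize h@_m).-1.

Definition pp_ydeg (R : A) (n : nat) : Prop :=
  exists (c : {mpoly C[2]}) (h : A), is_content c R /\ R = c *: h /\ ydeg h = n.

(* Main.v *)
(* A point of (Z(w) ∩ D) \ GG is projected from (0:0:1) to a line (1:t), a root
   of R(1,t,w) where R = Res_y3(G,Z). Write R = c h with c the content of R in u,
   so that h(l,u) is not the zero polynomial for any line l. Finitely many lines
   are bad: (0:1), the lines through GG, the t at which G(1,t,_) drops degree or
   has a multiple root, and the zeros of c. For generic w, no bad line is a root
   of h(_,w), and by (4) no point of Z(w) ∩ D outside GG lies on a bad line. At a
   good t the multiplicity of R(1,t,w) is the number of common zeros of G and
   Z(w) on the line: multiply the Sylvester matrix by the matrix of evaluations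
   at first-order lifts s_i + c_i (X - t) of the roots of G(1,t,_); by (3) the
   value of Z(w) at the lift of a common zero vanishes to order exactly one.
   Summing over the roots of h(_,w) counts deg h points. *)
Require Import Defs.
From HB Require Import structures.
From mathcomp Require Import all_boot all_order all_algebra.
From mathcomp Require Import complex.
From mathcomp Require Import Rstruct.
From mathcomp.multinomials Require Import mpoly.
From mathcomp Require Import ring zify.
From Stdlib Require Import Classical FunctionalExtensionality.
Set Implicit Arguments. Unset Strict Implicit. Unset Printing Implicit Defensive.
Import Order.TTheory GRing.Theory Num.Theory.
Local Open Scope ring_scope.

(** * Multivariate polynomials *)

(** The form [G] homogenizes [g] with y3, while the projection from (0:0:1) is read in the chart y1
    = 1, as polynomials in y3 over C[y2]. Irreducibility of [g] must therefore be carried from one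
    chart to the other. Together with Gauss's lemma it yields Bezout identities for [G] with its
    y3-derivative and with one fixed Z(w0), whose right-hand sides involve y2 only; their roots give
    bad lines that do not depend on w. The resultant is formed before u is specialized, so the
    y3-degree of Z(w) may drop below the one that fixes the size of the Sylvester matrix. The matrix
    argument tolerates this: it only asks that the leading coefficient of [G] survive at t.
    First-order lifts suffice because [G] vanishes to order two along them and Z(w) to order at most
    one, so that after the powers of X - t are extracted the matrix is block triangular at t. The
    coefficients of the resultant are binary forms over an algebraically closed field. A common
    factor of them thus shows as a common zero, and the content is a product of linear forms, found
    without any gcd. *)

Definition vec2 (T : Type) (a b : T) : 'I_2 -> T :=
  fun i => if i == inord 0 then a else b.

Definition vec3 (T : Type) (a b c : T) : 'I_3 -> T :=
  fun i => if i == inord 0 then a else if i == inord 1 then b else c.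

Lemma I2P (P : 'I_2 -> Prop) : P (inord 0) -> P (inord 1) -> forall i, P i.
Proof.
move=> P0 P1 j; rewrite -[j]inord_val.
by case: j => [[|[|]]].
Qed.

Lemma I3P (P : 'I_3 -> Prop) :
  P (inord 0) -> P (inord 1) -> P (inord 2) -> forall i, P i.
Proof.
move=> P0 P1 P2 j; rewrite -[j]inord_val.
by case: j => [[|[|[|]]]].
Qed.

Lemma inord_eq n (i j : nat) : (i < n.+1)%N -> (j < n.+1)%N ->
  (inord i == inord j :> 'I_n.+1) = (i == j).
Proof. by move=> hi hj; rewrite -val_eqE /= !inordK. Qed.

Lemma vec2E0 T (a b : T) : vec2 a b (inord 0) = a.
Proof. by rewrite /vec2 eqxx. Qed.
Lemma vec2E1 T (a b : T) : vec2 a b (inord 1) = b.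
Proof. by rewrite /vec2 inord_eq. Qed.
Lemma vec3E0 T (a b c : T) : vec3 a b c (inord 0) = a.
Proof. by rewrite /vec3 eqxx. Qed.
Lemma vec3E1 T (a b c : T) : vec3 a b c (inord 1) = b.
Proof. by rewrite /vec3 inord_eq // eqxx. Qed.
Lemma vec3E2 T (a b c : T) : vec3 a b c (inord 2) = c.
Proof. by rewrite /vec3 !inord_eq. Qed.
Definition vecE := (vec2E0, vec2E1, vec3E0, vec3E1, vec3E2).

Lemma big_I2 (R : Type) (idx : R) (op : Monoid.law idx) (F : 'I_2 -> R) :
  \big[op/idx]_(i < 2) F i = op (F (inord 0)) (F (inord 1)).
Proof.
rewrite big_ord_recl big_ord1; congr (op (F _) (F _)).
  by apply/val_inj; rewrite /= inordK.
by apply/val_inj; rewrite /= inordK.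
Qed.

Section Mmap.
Variables (n : nat) (R : nzRingType) (S T : comNzRingType).

Lemma mmap_ext (f f' : R -> S) (h h' : 'I_n -> S) (p : {mpoly R[n]}) :
  f =1 f' -> h =1 h' -> mmap f h p = mmap f' h' p.
Proof.
move=> ef eh; rewrite /mmap; apply: eq_bigr => m _; rewrite ef; congr (_ * _).
exact: mmap1_eq.
Qed.

Lemma rmorph_mmap (F : {rmorphism S -> T}) (f : R -> S) (h : 'I_n -> S)
    (p : {mpoly R[n]}) :
  F (mmap f h p) = mmap (F \o f) (F \o h) p.
Proof.
rewrite /mmap rmorph_sum; apply: eq_bigr => m _.
rewrite rmorphM /mmap1 rmorph_prod; congr (_ * _).
by apply: eq_bigr => i _; rewrite rmorphXn.
Qed.

End Mmap.

Lemma meval_mmap_id (n : nat) (R : comNzRingType) (v : 'I_n -> R)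
  (p : {mpoly R[n]}) : p.@[v] = mmap idfun v p.
Proof. by []. Qed.

Section Dvd.
Variables (n : nat) (R : idomainType).
Implicit Types (p q l : {mpoly R[n]}).

Definition mdvdR l p := exists q, p = q * l.

Variables (h : 'I_n -> {mpoly R[n]}) (l : {mpoly R[n]}).
Let kill := mmap (@mpolyC n R) h.
Hypothesis hl : forall i, mdvdR l ('X_i - h i).

Let congM a b c d : mdvdR l (a - b) -> mdvdR l (c - d) -> mdvdR l (a * c - b * d).
Proof.
move=> [u hu] [v hv]; exists (u * c + b * v).
rewrite mulrDl -mulrA [c * l]mulrC mulrA -hu -mulrA -hv.
by rewrite mulrBl mulrBr addrA subrK.
Qed.

Lemma mdvd_sub_subst p : mdvdR l (p - kill p).
Proof.
elim/mpolyind: p => [|c m p _ _ [q hq]].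
  by exists 0; rewrite /kill mmap0 subr0 mul0r.
suff [r hr] : mdvdR l ('X_[m] - kill 'X_[m]).
  exists (c%:MP * r + q); rewrite /kill mmapD mmapZ -mul_mpolyC /=.
  rewrite mulrDl -mulrA -hr -hq /kill mulrBr opprD addrACA //.
rewrite /kill mmapX /mmap1 mpolyXE_id.
apply: (big_rec2 (fun a b => mdvdR l (a - b))).
  by exists 0; rewrite subrr mul0r.
move=> i a b _ hab; apply: congM => //.
elim: (m i) => [|k IH]; first by exists 0; rewrite subrr mul0r.
by rewrite !exprS; apply: congM.
Qed.

Lemma subst_eq0_mdvd p : kill p = 0 -> mdvdR l p.
Proof. by move=> k0; have := mdvd_sub_subst p; rewrite k0 subr0. Qed.

Hypothesis kl : kill l = 0.

Lemma mdvd_subst_eq0 p : mdvdR l p -> kill p = 0.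
Proof. by move=> [q ->]; rewrite /kill rmorphM /= -/kill kl mulr0. Qed.

(** Under [hl] and [kl] the multiples of [l] are exactly the kernel of the substitution [kill]. Its
    target is a domain, so this kernel is a prime ideal. The lemma serves both for linear forms and
    for single variables. *)
Lemma mdvd_prime p q : mdvdR l (p * q) -> mdvdR l p \/ mdvdR l q.
Proof.
move=> /mdvd_subst_eq0 /eqP; rewrite /kill rmorphM mulf_eq0.
by case/orP=> /eqP k0; [left|right]; apply: subst_eq0_mdvd.
Qed.

End Dvd.

Lemma digits_inj (N n : nat) (a b : 'I_n -> nat) :
  (forall i, a i < N)%N -> (forall i, b i < N)%N ->
  (\sum_(i < n) a i * N ^ i = \sum_(i < n) b i * N ^ i)%N -> a =1 b.
Proof.
elim: n a b => [|n IH] a b ha hb; first by move=> _ [].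
rewrite !big_ord_recl !expn0 !muln1 => e.
have shift c : (\sum_(i < n) c (lift ord0 i) * N ^ (lift ord0 i)
   = (\sum_(i < n) c (lift ord0 i) * N ^ i) * N)%N.
  by rewrite big_distrl; apply: eq_bigr => i _ /=; rewrite -mulnA -expnSr.
rewrite !shift in e.
have e0 : a ord0 = b ord0.
  have := congr1 (modn^~ N) e.
  by rewrite /= ![(_ + _ * N)%N]addnC !modnMDl !modn_small.
have N0 : (0 < N)%N by apply: leq_ltn_trans (ha ord0).
move: e; rewrite e0 => /addnI /eqP; rewrite eqn_pmul2r // => /eqP e.
move=> i; case: (unliftP ord0 i) => [j ->|-> //].
exact: (IH (fun i => a (lift ord0 i)) (fun i => b (lift ord0 i))).
Qed.

Section Identity.
Variable (K : numFieldType).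

Lemma poly_eq0_horner (p : {poly K}) : (forall x, p.[x] = 0) -> p = 0.
Proof.
move=> h; apply/eqP/negPn/negP => p0.
pose rs := [seq (i%:R : K) | i <- iota 0 (size p)].
have rp : all (root p) rs by apply/allP => x _; rewrite /root h eqxx.
have urs : uniq rs.
  by rewrite map_inj_uniq ?iota_uniq // => i j /eqP; rewrite eqr_nat => /eqP.
by have := max_poly_roots p0 rp urs; rewrite size_map size_iota ltnn.
Qed.

Lemma poly_ext_horner (p q : {poly K}) : (forall x, p.[x] = q.[x]) -> p = q.
Proof.
move=> h; apply/eqP; rewrite -subr_eq0; apply/eqP/poly_eq0_horner => x.
by rewrite hornerD hornerN h subrr.
Qed.

Lemma poly_ext_horner_neq0 (p q : {poly K}) :
  (forall x, x != 0 -> p.[x] = q.[x]) -> p = q.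
Proof.
move=> h; apply: (mulfI (x := 'X)); first by rewrite polyX_eq0.
apply: poly_ext_horner => x; rewrite !hornerM hornerX.
by have [->|/h ->] := eqVneq x 0; rewrite ?mul0r.
Qed.

Variable n : nat.

(* Kronecker substitution X_i := x^(N^i) separates the monomials of p. *)
Lemma mpoly_eq0_meval (p : {mpoly K[n]}) : (forall v, p.@[v] = 0) -> p = 0.
Proof.
move=> h; set N := msize p.
pose w (m : 'X_{1..n}) := (\sum_(i < n) m i * N ^ i)%N.
have q0 : mmap polyC (fun i : 'I_n => 'X^(N ^ i)) p = 0.
  apply: poly_eq0_horner => x.
  rewrite -[LHS]/(horner_eval x _) rmorph_mmap -[RHS](h (fun i => x ^+ (N ^ i))).
  apply: mmap_ext => [c|i] /=; first by rewrite /horner_eval hornerC.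
  by rewrite /horner_eval hornerXn.
apply/mpolyP => m; rewrite mcoeff0; apply/eqP; apply: contraT.
rewrite -mcoeff_msupp => hm.
have := congr1 (fun q : {poly K} => q`_(w m)) q0.
rewrite /mmap coef_sum coef0 (bigD1_seq m) ?msupp_uniq //= big_seq_cond big1.
  rewrite addr0 coefCM /mmap1.
  rewrite (eq_bigr (fun i : 'I_n => ('X^(m i * N ^ i) : {poly K}))); last first.
    by move=> i _; rewrite -exprM mulnC.
  rewrite -expr_sum coefXn eqxx mulr1 => p0.
  by rewrite mcoeff_msupp p0 eqxx in hm.
move=> k /andP[hk nkm]; rewrite coefCM /mmap1.
rewrite (eq_bigr (fun i : 'I_n => ('X^(k i * N ^ i) : {poly K}))); last first.
  by move=> i _; rewrite -exprM mulnC.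
rewrite -expr_sum coefXn; case: eqP => [e|_]; last by rewrite mulr0.
have lt1 j : j \in msupp p -> forall i, (j i < N)%N.
  move=> hj i; apply: leq_ltn_trans (msize_mdeg_lt hj).
  by rewrite mdegE (bigD1 i) //= leq_addr.
case/eqP: nkm; apply/esym/mnmP.
by apply: (digits_inj (N := N)) => //; apply: lt1.
Qed.

Lemma mpoly_ext_meval (p q : {mpoly K[n]}) : (forall v, p.@[v] = q.@[v]) -> p = q.
Proof.
move=> h; apply/eqP; rewrite -subr_eq0; apply/eqP/mpoly_eq0_meval => v.
by rewrite mevalB h subrr.
Qed.

(** Multiplying both sides by ['X_i] makes the identity hold on the excluded hyperplane too. *)
Lemma mpoly_ext_meval_neq0 (i : 'I_n) (p q : {mpoly K[n]}) :
  (forall v, v i != 0 -> p.@[v] = q.@[v]) -> p = q.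
Proof.
move=> h; apply: (mulfI (x := 'X_i)).
  apply/eqP => X0; have := congr1 (fun p => p@_U_(i)) X0.
  by rewrite mcoeffXU eqxx mcoeff0; apply/eqP/oner_neq0.
apply: mpoly_ext_meval => v; rewrite !mevalM mevalXU.
by have [->|/h ->] := eqVneq (v i) 0; rewrite ?mul0r.
Qed.

Lemma meval_neq0 (p : {mpoly K[n]}) : p != 0 ->
  ~ (forall v, p.@[v] = 0).
Proof. by move=> p0 /mpoly_eq0_meval e; rewrite e eqxx in p0. Qed.

End Identity.

Section Identity2.
Variables (K : numFieldType) (n k : nat).
Implicit Types (p q : {mpoly {mpoly K[n]}[k]}).

Lemma meval_specialize p (w : 'I_k -> K) (y : 'I_n -> K) :
  (p.@[fun j => (w j)%:MP_[n]]).@[y] = mmap (meval y) w p.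
Proof.
rewrite meval_mmap_id -[LHS]/(meval y _) rmorph_mmap.
by apply: mmap_ext => // j; rewrite /= mevalC.
Qed.

Lemma mmap_meval_map p (w : 'I_k -> K) (y : 'I_n -> K) :
  mmap (meval y) w p = (map_mpoly (meval y) p).@[w].
Proof.
rewrite -[RHS]/(meval w _) /map_mpoly rmorph_mmap.
by apply: mmap_ext => [c|j] /=; rewrite ?mevalC ?mevalXU.
Qed.

Lemma mpoly2_eq_coef p q (y z : 'I_n -> K) (a b : K) :
  (forall w, a * mmap (meval y) w p = b * mmap (meval z) w q) ->
  forall m, a * (p@_m).@[y] = b * (q@_m).@[z].
Proof.
move=> h m.
have e : a *: map_mpoly (meval y) p = b *: map_mpoly (meval z) q.
  by apply: mpoly_ext_meval => w; rewrite !mevalZ -!mmap_meval_map.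
by have := congr1 (mcoeff m) e; rewrite !mcoeffZ !mcoeff_map_mpoly.
Qed.

Lemma mpoly2_eq0 p (i : 'I_n) :
  (forall y w, y i != 0 -> mmap (meval y) w p = 0) -> p = 0.
Proof.
move=> h; apply/mpolyP => m; rewrite mcoeff0.
apply: (mpoly_ext_meval_neq0 (i := i)) => y hy.
have := @mpoly2_eq_coef p 0 y y 1 1 _ m.
rewrite !mul1r mcoeff0; apply => w; rewrite !mul1r h //.
by rewrite mmap0.
Qed.

End Identity2.

Section Homog.
Variables (K : numFieldType) (n : nat).
Implicit Types (p : {mpoly K[n]}).

Lemma dhomog_scale d p : p \is d.-homog ->
  forall (x : K) v, p.@[fun i => x * v i] = x ^+ d * p.@[v].
Proof.
move=> hp x v; rewrite !mevalE mulr_sumr big_seq [RHS]big_seq.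
apply: eq_bigr => m hm; rewrite mulrCA; congr (_ * _).
have -> : d = (\sum_(i < n) m i)%N by rewrite -mdegE; apply/esym/(dhomog_mf hp hm).
rewrite -[in RHS]prodrXr -big_split /=.
by apply: eq_bigr => i _; rewrite exprMn.
Qed.

(** The scalar 2 alone is enough: comparing the coefficients of p(2v) and p(v) at [m] gives 2^(k +
    mdeg m) = 2^l, and powers of 2 are distinct in characteristic zero. The factor [r] lets
    homogeneity pass to a quotient; the weight [k] on the left avoids a subtraction. *)
Lemma scale_dhomog (k l : nat) (r p : {mpoly K[n]}) : r != 0 ->
  (forall (x : K) v, x != 0 ->
     x ^+ k * (p.@[fun i => x * v i] * r.@[v]) = x ^+ l * (p.@[v] * r.@[v])) ->
  {in msupp p, forall m, (k + mdeg m)%N = l}.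
Proof.
move=> r0 h m hm; have t0 : (2%:R : K) != 0 by rewrite pnatr_eq0.
pose q := mmap (@mpolyC n K) (fun i => 2%:R *: 'X_i) p.
have e : 2%:R ^+ k *: q = 2%:R ^+ l *: p.
  apply: (mulIf r0); rewrite -!scalerAl; apply: mpoly_ext_meval => v.
  rewrite !mevalZ !mevalM -h //; congr (_ * (_ * _)).
  rewrite meval_mmap_id -[LHS]/(meval v _) rmorph_mmap.
  by apply: mmap_ext => [c|i] /=; rewrite ?mevalC ?mevalZ ?mevalXU.
have qm : q@_m = 2%:R ^+ mdeg m * p@_m.
  rewrite /q /mmap raddf_sum /= (bigD1_seq m) ?msupp_uniq //=.
  have mmE (m' : 'X_{1..n}) : mmap1 (fun i => 2%:R *: 'X_i : {mpoly K[n]}) m'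
     = 2%:R ^+ mdeg m' *: 'X_[m'].
    rewrite /mmap1 mdegE -prodrXr mpolyXE_id -scaler_prod.
    by apply: eq_bigr => i _; rewrite exprZn.
  rewrite big1 => [|m' nm]; last first.
    by rewrite mcoeffCM mmE mcoeffZ mcoeffX (negbTE nm) !mulr0.
  by rewrite addr0 mcoeffCM mmE mcoeffZ mcoeffX eqxx mulr1 mulrC.
have := congr1 (mcoeff m) e; rewrite !mcoeffZ qm mulrA -exprD => /mulIf.
rewrite -mcoeff_msupp => /(_ hm) /eqP; rewrite -!natrX eqr_nat.
by rewrite eqn_exp2l // => /eqP.
Qed.

End Homog.

(** * Binary forms and contents *)

Section BinaryForms.
Variable K : numClosedFieldType.
Implicit Types (p q : {mpoly K[2]}) (a b : K).

Definition lin a b : {mpoly K[2]} := b *: 'X_(inord 0) - a *: 'X_(inord 1).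

Lemma lin_meval a b v : (lin a b).@[v] = b * v (inord 0) - a * v (inord 1).
Proof. by rewrite mevalB !mevalZ !mevalXU. Qed.

Lemma lin_neq0 a b : (a != 0) || (b != 0) -> lin a b != 0.
Proof.
move=> ab; apply/eqP => l0.
have := lin_meval a b (vec2 1 0); have := lin_meval a b (vec2 0 1).
rewrite l0 !meval0 !vecE !mulr1 !mulr0 subr0 sub0r => /eqP.
rewrite eq_sym oppr_eq0 => /eqP a0 /esym /eqP; rewrite a0 in ab *.
by rewrite eqxx /= in ab; rewrite (negbTE ab).
Qed.

(** The substitution solves the equation of the line for one variable, so its values run through the
    multiples of (a, b). A polynomial vanishing on these is killed, hence divisible by [lin a b]. *)
Lemma lin_subst a b : (a != 0) || (b != 0) ->
  exists h : 'I_2 -> {mpoly K[2]},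
  [/\ forall i, mdvdR (lin a b) ('X_i - h i),
      mmap (@mpolyC 2 K) h (lin a b) = 0
    & forall v, exists s, forall i, (h i).@[v] = s * vec2 a b i].
Proof.
case/orP=> [a0|b0].
  exists (vec2 'X_(inord 0) ((b / a) *: 'X_(inord 0))); split.
  - apply: I2P; rewrite vecE; first by exists 0; rewrite subrr mul0r.
    exists (- a^-1)%:MP; rewrite mul_mpolyC /lin scaleNr scalerBr opprB !scalerA.
    by rewrite mulVf // scale1r mulrC.
  - rewrite /lin mmapB !mmapZ !mmapX !mmap1U !vecE -!mul_mpolyC.
    by rewrite mulrA -mpolyCM mulrCA mulfV // mulr1 subrr.
  - move=> v; exists (v (inord 0) / a); apply: I2P; rewrite !vecE ?mevalZ mevalXU.
      by rewrite divfK.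
    by rewrite mulrC -mulrA [b / a]mulrC.
exists (vec2 ((a / b) *: 'X_(inord 1)) 'X_(inord 1)); split.
- apply: I2P; rewrite vecE; last by exists 0; rewrite subrr mul0r.
  exists (b^-1)%:MP; rewrite mul_mpolyC /lin scalerBr !scalerA.
  by rewrite mulVf // scale1r mulrC.
- rewrite /lin mmapB !mmapZ !mmapX !mmap1U !vecE -!mul_mpolyC.
  by rewrite mulrA -mpolyCM mulrCA mulfV // mulr1 subrr.
- move=> v; exists (v (inord 1) / b); apply: I2P; rewrite !vecE ?mevalZ mevalXU.
    by rewrite mulrC -mulrA [a / b]mulrC.
  by rewrite divfK.
Qed.

Lemma lin_dvd a b p : (a != 0) || (b != 0) ->
  (forall s, p.@[fun i => s * vec2 a b i] = 0) -> mdvdR (lin a b) p.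
Proof.
move=> /lin_subst [h [h1 h2 h3]] p0; apply: (subst_eq0_mdvd h1).
apply: mpoly_eq0_meval => v; have [s hs] := h3 v.
rewrite -[RHS](p0 s) meval_mmap_id -[LHS]/(meval v _) rmorph_mmap.
by apply: mmap_ext => [c|i] /=; rewrite ?mevalC.
Qed.

Lemma lin_prime a b p q : (a != 0) || (b != 0) ->
  mdvdR (lin a b) (p * q) -> mdvdR (lin a b) p \/ mdvdR (lin a b) q.
Proof. by move=> /lin_subst [h [h1 h2 _]]; apply: mdvd_prime h1 h2 _ _. Qed.

Definition deh p : {poly K} := mmap polyC (vec2 1 'X) p.

Lemma deh_horner p t : (deh p).[t] = p.@[vec2 1 t].
Proof.
rewrite -[LHS]/(horner_eval t _) rmorph_mmap.
apply: mmap_ext => [c|]; first by rewrite /= /horner_eval hornerC.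
by apply: I2P; rewrite /= !vecE /horner_eval ?hornerC ?hornerX.
Qed.

Lemma dehE p : deh p = \sum_(m <- msupp p) p@_m *: 'X^(m (inord 1)).
Proof.
apply: eq_bigr => m _; rewrite mul_polyC /mmap1 big_I2 !vecE expr1n.
by congr (_ *: _); apply: mul1r.
Qed.

Lemma mdeg2 (m : 'X_{1..2}) : mdeg m = (m (inord 0) + m (inord 1))%N.
Proof. by rewrite mdegE big_I2. Qed.

Lemma size_deh d p : p \is d.-homog -> (size (deh p) <= d.+1)%N.
Proof.
move=> hp; rewrite dehE big_seq; apply: (leq_trans (size_sum _ _ _)).
apply/bigmax_leqP_seq => m hm _; apply: (leq_trans (size_scale_leq _ _)).
rewrite size_polyXn ltnS -(dhomog_mf hp hm) [X in (_ <= X)%N]mdeg2.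
exact: leq_addl.
Qed.

(** The coefficient is taken at the nominal degree [d], which [deh p] need not reach. Only the pure
    power of y2 contributes to it, as it does to the value at (0:1), the point that the chart
    misses. *)
Lemma deh_top d p : p \is d.-homog -> (deh p)`_d = p.@[vec2 0 1].
Proof.
move=> hp; rewrite dehE mevalE coef_sum big_seq [RHS]big_seq.
apply: eq_bigr => m hm; rewrite coefZ coefXn -(dhomog_mf hp hm); congr (_ * _).
have -> : (mdeg m == m (inord 1)) = (m (inord 0) == 0%N).
  by rewrite mdeg2 -{2}[m (inord 1)]add0n eqn_add2r.
by rewrite big_I2 !vecE expr1n /= mulr1 expr0n.
Qed.

Lemma form_root d p : (0 < d)%N -> p \is d.-homog ->
  exists a b, ((a != 0) || (b != 0)) /\ p.@[vec2 a b] = 0.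
Proof.
move=> d0 hp; have [sp|sp] := leqP (size (deh p)) 1; last first.
  have /closed_rootP [t /rootP ht] : size (deh p) != 1%N by rewrite gtn_eqF.
  by exists 1, t; rewrite oner_neq0 -deh_horner.
(* A constant [deh p] may have no root at all, but its coefficient of degree [d > 0] is zero, so the
   form vanishes at (0:1). *)
exists 0, 1; rewrite oner_neq0 orbT; split=> //.
by rewrite -(deh_top hp) nth_default // (leq_trans sp).
Qed.

Definition ray (v : 'I_2 -> K) p : {poly K} :=
  mmap polyC (fun i => (v i)%:P * 'X) p.

Lemma ray_horner v p s : (ray v p).[s] = p.@[fun i => s * v i].
Proof.
rewrite -[LHS]/(horner_eval s _) rmorph_mmap.
apply: mmap_ext => [c|i]; rewrite /= /horner_eval ?hornerC //.
by rewrite hornerM hornerC hornerX mulrC.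
Qed.

Lemma rayE v p :
  ray v p = \sum_(m <- msupp p) (p@_m * \prod_i v i ^+ m i) *: 'X^(mdeg m).
Proof.
apply: eq_bigr => m _; rewrite -mul_polyC polyCM -mulrA; congr (_ * _).
rewrite /mmap1 mdegE -prodrXr rmorph_prod -big_split; apply: eq_bigr => i _ /=.
by rewrite exprMn rmorphXn.
Qed.

Lemma coef_ray v p k : (ray v p)`_k = (pihomog mdeg k p).@[v].
Proof.
rewrite rayE pihomogE coef_sum raddf_sum /= [RHS]big_mkcond /=.
apply: eq_bigr => m _; rewrite coefZ coefXn eq_sym.
case: eqP => _; last by rewrite mulr0.
by rewrite mulr1 mevalZ mevalX.
Qed.

Lemma size_ray v p : (size (ray v p) <= msize p)%N.
Proof.
rewrite rayE big_seq; apply: (leq_trans (size_sum _ _ _)).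
apply/bigmax_leqP_seq => m hm _; apply: (leq_trans (size_scale_leq _ _)).
by rewrite size_polyXn msize_mdeg_lt.
Qed.

Lemma dhomog_msizeE n d (p : {mpoly K[n]}) :
  p != 0 -> p \is d.-homog -> msize p = d.+1.
Proof.
move=> p0 hp; rewrite -mlead_deg //; congr _.+1.
exact: (dhomog_mf hp (mlead_supp p0)).
Qed.

(* If the top form of e vanished at v but p did not, the restriction of q * e to
   the ray through v would have degree less than that of p. *)
Lemma top_root_of_divisor d e p q (v : 'I_2 -> K) :
  p \is d.-homog -> p = q * e -> (pihomog mdeg (msize e).-1 e).@[v] = 0 ->
  p.@[v] = 0.
Proof.
move=> hp pE e0; have [->|p0] := eqVneq p 0; first by rewrite meval0.
have [q0 en0] : q != 0 /\ e != 0.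
  by apply/andP; rewrite -negb_or -mulf_eq0 -pE.
apply/eqP; apply: contraT => pv.
have se : (size (ray v e) < msize e)%N.
  have := size_ray v e; rewrite leq_eqVlt => /orP[/eqP s|//].
  have r0 : ray v e != 0 by rewrite -size_poly_eq0 s msize_poly_eq0.
  by move: e0; rewrite -coef_ray -s => /eqP; rewrite lead_coef_eq0 (negbTE r0).
have sp : size (ray v p) = msize p.
  have -> : ray v p = p.@[v] *: 'X^d.
    apply: poly_ext_horner => s; rewrite ray_horner (dhomog_scale hp).
    by rewrite hornerZ hornerXn mulrC.
  by rewrite size_scale // size_polyXn (dhomog_msizeE p0 hp).
have sM : (size (ray v p) <= (size (ray v q) + size (ray v e)).-1)%N.
  by rewrite pE /ray rmorphM; apply: size_polyMleq.
move: sM; rewrite sp pE msizeM //.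
have := size_ray v q; move: se.
have : (0 < msize q)%N by rewrite lt0n msize_poly_eq0.
move: (msize q) (msize e) (size (ray v q)) (size (ray v e)) => i j k l.
lia.
Qed.

End BinaryForms.

Definition formcoef (n : nat) (R : A) := forall m, R@_m \is n.-homog.

Lemma mdvd_coef (l : {mpoly C[2]}) (R : A) : (forall m, mdvd l R@_m) ->
  exists R' : A, R = l *: R'.
Proof.
elim/mpolyind: R => [|c m p hm _ IH] h; first by exists 0; rewrite scaler0.
have pm : p@_m = 0 by exact: memN_msupp_eq0.
have [c' hc] : mdvd l c.
  by have := h m; rewrite mcoeffD mcoeffZ mcoeffX eqxx mulr1 pm addr0.
have [p' ->] : exists p' : A, p = l *: p'.
  apply: IH => m'; have := h m'; rewrite mcoeffD mcoeffZ mcoeffX.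
  have [<- _|_] := eqVneq m m'; last by rewrite mulr0 add0r.
  by rewrite pm; exists 0; rewrite mul0r.
by exists (c' *: 'X_[m] + p'); rewrite scalerDr scalerA hc mulrC.
Qed.

Lemma divide_form n (l : {mpoly C[2]}) (R R' : A) : R != 0 -> l \is 1.-homog ->
  l != 0 -> formcoef n R -> R = l *: R' ->
  exists2 n', n = n'.+1 & formcoef n' R'.
Proof.
move=> R0 hl l0 hR RE.
have hm m mm : mm \in msupp (R'@_m) -> (1 + mdeg mm)%N = n.
  apply: (scale_dhomog (r := l)) => // x v x0.
  have e : R@_m = R'@_m * l by rewrite RE mcoeffZ mulrC.
  rewrite -mevalM -e -(dhomog_scale (hR m)) e mevalM (dhomog_scale hl) expr1.
  ring.
have [m hm0] : exists m, R'@_m != 0.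
  apply: NNPP => h; case/negP: R0; rewrite RE; apply/eqP.
  rewrite (_ : R' = 0) ?scaler0 //; apply/mpolyP => m; rewrite mcoeff0.
  by apply/eqP; apply: contraT => hm0; case: h; exists m.
exists (mdeg (mlead R'@_m)); first by rewrite -(hm m _ (mlead_supp hm0)) add1n.
move=> m'; apply/dhomogP => mm /hm; rewrite -(hm m _ (mlead_supp hm0)).
by move=> /addnI.
Qed.

Lemma lin_homog (K : numClosedFieldType) (a b : K) : lin a b \is 1.-homog.
Proof.
rewrite /lin; apply/dhomogP => m; rewrite mcoeff_msupp => hm.
have : m = U_(inord 0)%MM \/ m = U_(inord 1)%MM.
  move: hm; rewrite mcoeffB !mcoeffZ !mcoeffX.
  have [->|_] := eqVneq U_(inord 0)%MM m; first by left.
  have [->|_] := eqVneq U_(inord 1)%MM m; first by right.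
  by rewrite !mulr0 subrr eqxx.
by case=> ->; exact: mdeg1.
Qed.

(** A common divisor [d] is not known to be homogeneous. If it is not constant, its top form still
    has a zero (a:b), and every coefficient of [R] vanishes there, against the hypothesis. *)
Lemma is_content1 n (R : A) : R != 0 -> formcoef n R ->
  (forall a b, (a != 0) || (b != 0) -> exists m, (R@_m).@[vec2 a b] != 0) ->
  is_content 1 R.
Proof.
move=> R0 hR hn; split=> [m|d hd]; first by exists R@_m; rewrite mulr1.
have [|sd] := leqP (msize d) 1.
  move=> /msize1_polyC dE; exists (d@_0%MM)^-1%:MP.
  rewrite [in X in _ * X]dE -mpolyCM mulVf //; apply: contraNneq R0 => d0.
  apply/eqP/mpolyP => m; have [q ->] := hd m.
  by rewrite dE d0 mpolyC0 mulr0 mcoeff0.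
have [a [b [ab rd]]] : exists a b : C, ((a != 0) || (b != 0)) /\
    (pihomog mdeg (msize d).-1 d).@[vec2 a b] = 0.
  by apply: form_root (pihomogP _ _ _); rewrite -subn1 subn_gt0.
have [m] := hn a b ab; have [q qE] := hd m.
by rewrite (top_root_of_divisor (hR m) qE rd) eqxx.
Qed.

(** The form [lin a b] is prime: either it divides the common divisor [d], and the quotient divides
    [c], or it does not, and then [d] already divides every coefficient of [R]. *)
Lemma is_content_linM (a b : C) (c : {mpoly C[2]}) (R : A) :
  (a != 0) || (b != 0) -> is_content c R -> is_content (c * lin a b) (lin a b *: R).
Proof.
move=> ab [cR cmax]; have l0 := lin_neq0 ab; split=> [m|d hd].
  have [q qE] := cR m; exists q; rewrite mcoeffZ qE; ring.
have [[d' dE]|nd] := classic (mdvd (lin a b) d).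
  have [q ->] : mdvd d' c; last by exists q; rewrite dE; ring.
  apply: cmax => m; have [q] := hd m; rewrite mcoeffZ dE mulrC mulrA => /(mulIf l0) ->.
  by exists q.
have [q ->] : mdvd d c; last by exists (q * lin a b); ring.
apply: cmax => m; have [q qE] := hd m; rewrite mcoeffZ in qE.
have : mdvd (lin a b) (q * d) by exists R@_m; rewrite -qE mulrC.
case/(lin_prime ab) => [[q' q'E]|//]; exists q'; apply: (mulfI l0).
by rewrite qE q'E; ring.
Qed.

(** A common zero of all coefficients gives a linear form to split off, which lowers the degree by
    one. Once no common zero is left the content is 1, so [h] comes with nonvanishing on every line,
    the property needed later for generic w. *)
Lemma content_exists n (R : A) : R != 0 -> formcoef n R ->
  exists c (h : A) n', [/\ is_content c R, R = c *: h, formcoef n' h &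
    forall a b, (a != 0) || (b != 0) -> exists m, (h@_m).@[vec2 a b] != 0].
Proof.
elim/ltn_ind: n R => n IH R R0 hR.
have [[a [b [ab hz]]]|hn] := classic (exists a b : C,
    ((a != 0) || (b != 0)) /\ forall m, (R@_m).@[vec2 a b] = 0); last first.
  have h a b : (a != 0) || (b != 0) -> exists m, (R@_m).@[vec2 a b] != 0.
    move=> ab; apply: NNPP => hm; apply: hn; exists a, b; split=> // m.
    by apply/eqP; apply: contraT => rm; case: hm; exists m.
  by exists 1, R, n; rewrite scale1r; split=> //; apply: is_content1 hR h.
have [R' RE] : exists R' : A, R = lin a b *: R'.
  apply: mdvd_coef => m; apply: lin_dvd => // s.
  by rewrite (dhomog_scale (hR m)) hz mulr0.
have [n' ne hR'] := divide_form R0 (lin_homog a b) (lin_neq0 ab) hR RE.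
have R'0 : R' != 0 by apply: contraNneq R0 => e; rewrite RE e scaler0.
have [|c [h [k [hc hE hk hp]]]] := IH n' _ R' R'0 hR'; first by rewrite ne.
exists (c * lin a b), h, k; split; [| |exact: hk|exact: hp].
  by rewrite RE; apply: is_content_linM ab hc.
by rewrite [c * _]mulrC -scalerA -hE -RE.
Qed.

(** * Bivariate polynomials and the Sylvester matrix *)

Section Bivariate.
Variable K : numClosedFieldType.
Implicit Types (f z a b : {poly {poly K}}) (c : {poly K}) (t : K).

Definition spec t f : {poly K} := map_poly (horner_eval t) f.

Lemma spec_horner t f s : (spec t f).[s] = f.[s%:P].[t].
Proof.
rewrite -[RHS]/(horner_eval t f.[s%:P]) -horner_map /=.
by rewrite /horner_eval hornerC.
Qed.

Lemma spec_eq0 t f : spec t f = 0 -> exists g, f = ('X - t%:P) *: g.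
Proof.
move=> f0; exists (map_poly (fun c => c %/ ('X - t%:P)) f).
apply/polyP => i; rewrite coefZ coef_map_id0 ?div0p // mulrC divpK //.
rewrite dvdp_XsubCl /root.
by have := congr1 (fun p : {poly K} => p`_i) f0; rewrite coef_map coef0 => /eqP.
Qed.

Lemma specZ t c f : spec t (c *: f) = c.[t] *: spec t f.
Proof. by rewrite /spec map_polyZ. Qed.

Lemma specM t f g : spec t (f * g) = spec t f * spec t g.
Proof. exact: rmorphM. Qed.

Lemma polyK_ind (P : {poly K} -> Prop) :
  (forall x : K, x != 0 -> P x%:P) ->
  (forall t c, c != 0 -> P c -> P (('X - t%:P) * c)) -> forall c, c != 0 -> P c.
Proof.
move=> P0 PS c; move: {2}(size c) (leqnn (size c)) => n.
elim: n c => [|n IH] c sc c0.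
  by rewrite size_poly_leq0 (negbTE c0) in sc.
have [s1|s1] := eqVneq (size c) 1%N.
  by have := s1 => /eqP /size_poly1P [x x0 ->]; apply: P0.
have /closed_rootP [t /factor_theorem [q qE]] := s1.
have q0 : q != 0 by apply: contraNneq c0 => q0; rewrite qE q0 mul0r.
rewrite qE mulrC; apply: PS => //; apply: IH => //.
by move: sc; rewrite qE size_mul ?polyXsubC_eq0 // size_XsubC addn2.
Qed.

Lemma XsubC_scale_inj t : injective (fun f => ('X - t%:P) *: f).
Proof.
move=> f g /=; rewrite -!mul_polyC => /mulfI; apply.
by rewrite polyC_eq0 polyXsubC_eq0.
Qed.

(* Each linear factor of c, being prime in K[t][s], divides a or b. *)
Lemma clear_denominator c f a b : c != 0 -> c *: f = a * b ->
  exists a' b', [/\ f = a' * b', size a' = size a & size b' = size b].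
Proof.
move=> c0; move: c c0 f a b; apply: polyK_ind => [x x0|t c c0 IH] f a b e.
  exists ((x^-1)%:P *: a), b; split=> //.
    rewrite -scalerAl -e scalerA -polyCM mulVf // scale1r //.
  by rewrite size_scale // polyC_eq0 invr_eq0.
have : spec t a * spec t b = 0.
  rewrite -specM -e specZ hornerM hornerXsubC subrr mul0r.
  by rewrite scale0r.
have sz (g : {poly {poly K}}) : size (('X - t%:P) *: g) = size g by rewrite size_scale ?polyXsubC_eq0.
move=> /eqP; rewrite mulf_eq0 => /orP[] /eqP /spec_eq0 [g gE];
  rewrite gE -?scalerAl -?scalerAr -scalerA in e; move/XsubC_scale_inj: e => /IH.
  by move=> [a' [b' [-> sa sb]]]; exists a', b'; rewrite gE sz.
by move=> [a' [b' [-> sa sb]]]; exists a', b'; rewrite gE sz.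
Qed.

(** No specialization of [f] vanishes, so each linear factor of [c] has to divide the cofactor
    [w]. *)
Lemma clear_denominator_primitive c z f w : c != 0 ->
  (forall t, spec t f != 0) -> c *: z = f * w -> exists w', z = f * w'.
Proof.
move=> c0 fp; move: c c0 z w; apply: polyK_ind => [x x0|t c c0 IH] z w e.
  exists ((x^-1)%:P *: w).
  by rewrite -scalerAr -e scalerA -polyCM mulVf // scale1r.
have : spec t f * spec t w = 0.
  rewrite -specM -e specZ hornerM hornerXsubC subrr mul0r.
  by rewrite scale0r.
move=> /eqP; rewrite mulf_eq0 (negbTE (fp t)) => /eqP /spec_eq0 [g gE].
by rewrite gE -scalerAr -scalerA in e; move/XsubC_scale_inj: e => /IH.
Qed.

Lemma irreducible_dvd_of_gcd f z : f != 0 ->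
  (forall a b, f = a * b -> (size a <= 1)%N \/ (size b <= 1)%N) ->
  (forall t, spec t f != 0) ->
  (1 < size (gcdp f z))%N -> exists w, z = f * w.
Proof.
move=> f0 firr fp sg; set g := gcdp f z in sg.
have /Pdiv.WeakIdomain.dvdpP [[c q] /= c0 e] : g %| f by apply: dvdp_gcdl.
have /Pdiv.WeakIdomain.dvdpP [[c' w] /= c'0 e'] : g %| z by apply: dvdp_gcdr.
have [a [b [fE sa sb]]] := clear_denominator c0 e.
have sq : (size q <= 1)%N.
  by have := firr _ _ fE; rewrite sa sb; case=> //; rewrite leqNgt sg.
have q0 : q != 0.
  apply: contraNneq f0 => q0; move: e; rewrite q0 mul0r => /eqP.
  by rewrite -mul_polyC mulf_eq0 polyC_eq0 (negbTE c0).
have [u qE] : exists u, q = u%:P by exists q`_0; apply: size1_polyC.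
have u0 : u != 0 by rewrite qE polyC_eq0 in q0.
apply: (@clear_denominator_primitive (u * c') z f (c *: w)) => //.
  by rewrite mulf_neq0.
have -> : f * (c *: w) = (c *: f) * w by rewrite -scalerAr scalerAl.
by rewrite -scalerA e' e qE mul_polyC -scalerAl [w * _]mulrC.
Qed.

Lemma coprime_bezout f z : f != 0 -> (size (gcdp f z) <= 1)%N ->
  exists u v c, c != 0 /\ u * f + v * z = c%:P.
Proof.
move=> f0 sg; have [[u v] /= /Pdiv.CommonIdomain.eqpP [[c1 c2] /= /andP[c10 c20] e]] :=
  Pdiv.CommonIdomain.Bezoutp f z.
have gE : gcdp f z = ((gcdp f z)`_0)%:P by apply: size1_polyC.
have g0 : gcdp f z != 0 by rewrite gcdp_eq0 (negbTE f0).
exists (c1 *: u), (c1 *: v), (c2 * (gcdp f z)`_0); split.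
  by rewrite mulf_neq0 //; rewrite gE polyC_eq0 in g0.
by rewrite polyCM -gE mul_polyC -e scalerDr !scalerAl.
Qed.

Lemma taylor1 (R : comNzRingType) (f : {poly R}) (x h : R) :
  exists r, f.[x + h] = f.[x] + f^`().[x] * h + h ^+ 2 * r.
Proof.
elim/poly_ind: f => [|f c [r IH]].
  by exists 0; rewrite deriv0 !horner0 mul0r mulr0 !addr0.
exists (f^`().[x] + (x + h) * r); rewrite derivD derivC addr0 derivM derivX.
rewrite !hornerE IH; ring.
Qed.

Lemma first_order_lift f (s t : K) : f.[s%:P].[t] = 0 -> f^`().[s%:P].[t] != 0 ->
  exists (x : K) (e : {poly K}), f.[s%:P + x%:P * ('X - t%:P)] = ('X - t%:P) ^+ 2 * e.
Proof.
move=> /rootP /factor_theorem [u uE] d0.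
(* One Newton step: [u.[t]] is the derivative of [f] in the parameter at (s, t), and [c] makes the
   first-order term u + d c vanish at [t]. *)
set d := f^`().[s%:P] in d0; pose c : K := - u.[t] / d.[t].
have [r rE] := taylor1 f s%:P (c%:P * ('X - t%:P)).
have /rootP /factor_theorem [k kE] : (u + d * c%:P).[t] = 0.
  by rewrite hornerD hornerM hornerC /c mulrC divfK // subrr.
exists c, (k + c%:P ^+ 2 * r); rewrite rE uE -/d.
have -> : u = k * ('X - t%:P) - d * c%:P by rewrite -kE addrK.
ring.
Qed.

End Bivariate.

Section Sylvester.
Variables (K : numClosedFieldType) (B : comNzRingType).
Variables (psi : {rmorphism B -> {poly K}}) (P Q : {poly B}) (t : K).
Let m := (size P).-1.
Let e := (size Q).-1.
Let f := map_poly psi P.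
Let z := map_poly psi Q.
Variables (sg ef w : 'I_m -> {poly K}) (b : 'I_m -> bool).
Hypothesis s_inj : injective (fun i => (sg i).[t]).
Hypothesis lcP : (psi (lead_coef P)).[t] != 0.
Hypothesis fE : forall i, f.[sg i] = ('X - t%:P) ^+ 2 * ef i.
Hypothesis zE : forall i, z.[sg i] = ('X - t%:P) ^+ b i * w i.
Hypothesis w0 : forall i, (w i).[t] != 0.

(** Since [m] and [e] are degrees before [psi] is applied, [z] may have degree below [e]. [Wl]
    selects the coefficients of degree at least [m], and [Wr] evaluates a row of coefficients at the
    lifts. [Em] has exponent [2 - b j] because X - t to the power [b j] is extracted from column
    [j]; what remains is positive. *)
Let U : 'M[{poly K}]_(e, e + m) := \matrix_(i, k) ('X^i * f)`_k.
Let L : 'M[{poly K}]_(m, e + m) := \matrix_(i, k) ('X^i * z)`_k.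
Let Wl : 'M[{poly K}]_(e + m, e) := \matrix_(k, j) (k == m + j :> nat)%N%:R.
Let Wr : 'M[{poly K}]_(e + m, m) := \matrix_(k, i) (sg i) ^+ k.
Let Tm : 'M[{poly K}]_e := \matrix_(i, j) ('X^i * f)`_(m + j)%N.
Let Ym : 'M[{poly K}]_(m, e) := \matrix_(i, j) ('X^i * z)`_(m + j)%N.
Let Em : 'M[{poly K}]_(e, m) :=
  \matrix_(i, j) (sg j ^+ i * (('X - t%:P) ^+ (2 - b j) * ef j)).
Let Vm : 'M[{poly K}]_m := \matrix_(i, j) (sg j ^+ i * w j).
Let dg : 'rV[{poly K}]_m := \row_j ('X - t%:P) ^+ b j.

Let sf : (size f <= m.+1)%N.
Proof. by rewrite /f (leq_trans (size_poly _ _)) // /m leqSpred. Qed.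

Let sz : (size z <= e.+1)%N.
Proof. by rewrite /z (leq_trans (size_poly _ _)) // /e leqSpred. Qed.

Lemma Sylvester_rows : map_mx psi (Sylvester_mx P Q) = col_mx U L.
Proof.
apply/matrixP => i j; rewrite mxE Sylvester_mxE mxE.
case: (split i) => k; rewrite mxE coefXnM ltnNge; case: leqP => //= _;
  by rewrite ?mulr1n ?mulr0n ?raddf0 // coef_map.
Qed.

Lemma mul_coefs_pow n (M : 'M[{poly K}]_(n, e + m))
    (h : 'I_n -> {poly {poly K}}) :
  (forall i j, M i j = (h i)`_j) -> (forall i, (size (h i) <= e + m)%N) ->
  M *m Wr = \matrix_(i, j) (h i).[sg j] /\
  M *m Wl = \matrix_(i, j) (h i)`_(m + j).
Proof.
move=> hM sh; split; apply/matrixP => i j; rewrite !mxE.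
  rewrite (horner_coef_wide _ (sh i)); apply: eq_bigr => l _.
  by rewrite hM !mxE.
have lt : (m + j < e + m)%N by rewrite addnC ltn_add2r.
rewrite (bigD1 (Ordinal lt)) //= big1 ?addr0 => [|l nl].
  by rewrite hM mxE eqxx mulr1.
rewrite mxE; case: eqP => [l_eq|]; last by rewrite mulr0.
by case/eqP: nl; apply: val_inj.
Qed.

Lemma size_XnM_le n (g : {poly {poly K}}) i l : (size g <= l.+1)%N -> (i < n)%N ->
  (size ('X^i * g)%R <= n + l)%N.
Proof.
move=> sl hi; rewrite mulrC; have [->|g0] := eqVneq g 0; first by rewrite mul0r size_poly0.
rewrite size_mulXn //; lia.
Qed.

Lemma Sylvester_factor :
  map_mx psi (Sylvester_mx P Q) *m row_mx Wl Wr =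
  block_mx Tm Em Ym Vm *m block_mx 1%:M 0 0 (diag_mx dg).
Proof.
rewrite Sylvester_rows mul_col_row mulmx_block !mulmx0 !mulmx1 !addr0 !add0r.
have [ur ul] : U *m Wr = \matrix_(i, j) ('X^i * f).[sg j] /\
    U *m Wl = \matrix_(i, j) ('X^i * f)`_(m + j).
  apply: (mul_coefs_pow (h := fun i : 'I_e => 'X^i * f)) => [i j|i].
  - by rewrite mxE.
  - exact: size_XnM_le sf (ltn_ord i).
have [lr ll] : L *m Wr = \matrix_(i, j) ('X^i * z).[sg j] /\
    L *m Wl = \matrix_(i, j) ('X^i * z)`_(m + j).
  apply: (mul_coefs_pow (h := fun i : 'I_m => 'X^i * z)) => [i j|i].
  - by rewrite mxE.
  - by rewrite [(e + m)%N]addnC; apply: size_XnM_le sz (ltn_ord i).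
rewrite ur ul lr ll; congr block_mx; apply/matrixP => i j;
  rewrite mul_mx_diag !mxE hornerM hornerXn ?fE ?zE.
  by case: (b j); rewrite ?subn0 ?subn1 /=; ring.
by rewrite -mulrA [w j * _]mulrC.
Qed.

(** At X = t the block [Em] vanishes, [Tm] is triangular with [psi (lead_coef P)] on the diagonal,
    and [Vm] is a Vandermonde matrix at distinct points with columns scaled by the nonzero values of
    [w]. *)
Lemma det_eval_factor : (\det (block_mx Tm Em Ym Vm)).[t] != 0.
Proof.
rewrite -[_.[t]]/(horner_eval t _) -det_map_mx map_block_mx.
have -> : map_mx (horner_eval t) Em = 0.
  apply/matrixP => i j; rewrite !mxE /horner_eval !hornerM.
  rewrite !horner_exp hornerXsubC subrr expr0n.
  by case: (b j); rewrite /= mul0r mulr0.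
rewrite det_lblock mulf_neq0 //.
  rewrite det_trig.
    apply/prodf_neq0 => i _; rewrite !mxE coefXnM ltnNge leq_addl /= addnK.
    by rewrite coef_map.
  apply/is_trig_mxP => i j lij; rewrite !mxE coefXnM ifN -?leqNgt; last lia.
  by rewrite nth_default ?raddf0 // (leq_trans sf) //; lia.
have -> : map_mx (horner_eval t) Vm = Vandermonde m (\row_j (sg j).[t]) *m
    diag_mx (\row_j (w j).[t]).
  apply/matrixP => i j; rewrite mul_mx_diag !mxE /horner_eval.
  by rewrite hornerM horner_exp.
rewrite det_mulmx det_Vandermonde det_diag mulf_neq0 //.
  apply/prodf_neq0 => i _; apply/prodf_neq0 => j lij.
  rewrite !mxE subr_eq0; apply: contraTneq lij => /s_inj ->.
  by rewrite ltnn.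
by apply/prodf_neq0 => i _; rewrite mxE.
Qed.

(** A row vector in the kernel at X = t is a polynomial [g]: [Wl] forces its coefficients from
    degree [m] on to vanish, and [Wr] gives it [m] distinct roots. *)
Lemma det_eval_cofactor : (\det (row_mx Wl Wr)).[t] != 0.
Proof.
rewrite -[_.[t]]/(horner_eval t _) -det_map_mx; apply/det0P => -[v v0].
rewrite map_row_mx mul_mx_row -[0]row_mx0 => /eq_row_mx [vl vr].
case/negP: v0; pose g := rVpoly v.
have gk (k : 'I_(e + m)) : g`_k = v 0 k by rewrite coef_rVpoly_ord.
have g_high k : (m <= k)%N -> g`_k = 0.
  move=> mk; have [le|lt] := leqP (e + m) k.
    by rewrite nth_default // (leq_trans (size_poly _ _)).
  have lt' : (k - m < e)%N by lia.
  have := congr1 (fun M : 'M_(1, e) => M 0 (Ordinal lt')) vl.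
  rewrite !mxE (bigD1 (Ordinal lt)) //= big1 ?addr0 => [|l nl]; last first.
    rewrite !mxE subnKC //; case: eqP => [l_eq|_]; last by rewrite raddf0 mulr0.
    by case/eqP: nl; apply: val_inj.
  by rewrite !mxE /= subnKC // eqxx rmorph1 mulr1 -gk.
have sg_m : (size g <= m)%N by apply/leq_sizeP.
have rt i : root g (sg i).[t].
  apply/rootP; have := congr1 (fun M : 'M_(1, m) => M 0 i) vr.
  rewrite !mxE => <-; rewrite (horner_coef_wide _ (size_poly _ _)).
  by apply: eq_bigr => k _; rewrite gk !mxE rmorphXn.
have g0 : g = 0.
  apply/eqP; apply: contraTT sg_m => g0; rewrite -ltnNge.
  pose rs := [seq (sg i).[t] | i <- enum 'I_m].
  have := @max_poly_roots _ g rs g0.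
  rewrite size_map size_enum_ord; apply; last by rewrite map_inj_uniq ?enum_uniq.
  by apply/allP => x /mapP [i _ ->].
by apply/eqP/rowP => k; rewrite -gk g0 coef0 mxE.
Qed.

(** Determinants are compared in the factorization. Only the diagonal matrix of powers of X - t
    contributes to the order at [t], the other two factors being nonzero there. *)
Lemma mup_resultant : psi (resultant P Q) != 0 /\
  mup t (psi (resultant P Q)) = (\sum_i b i)%N.
Proof.
have := congr1 determinant Sylvester_factor.
rewrite !det_mulmx det_lblock det1 mul1r det_diag det_map_mx.
rewrite -/(resultant P Q) => E.
have prodE : \prod_i dg 0 i = ('X - t%:P) ^+ (\sum_i b i).
  by rewrite -prodrXr; apply: eq_bigr => i _; rewrite mxE.
rewrite prodE in E.
have := det_eval_factor; have := det_eval_cofactor.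
move: E; set dW := \det _; set dM := \det _ => E hW hM.
have r0 : psi (resultant P Q) != 0.
  apply: contraNneq hM => r0; move/eqP: E; rewrite r0 mul0r eq_sym mulf_eq0.
  by rewrite expf_eq0 polyXsubC_eq0 andbF orbF => /eqP ->; rewrite horner0.
split=> //; have := congr1 (mup t) E.
rewrite mupMl // mupMr // => ->.
by rewrite mup_XsubCX eqxx.
Qed.

End Sylvester.

(** * The affine chart of the curve *)

HB.instance Definition _ (K : numClosedFieldType) :=
  GRing.RMorphism.copy (@deh K) (mmap (@polyC K) (vec2 1 'X)).

Section Affine.
Variable K : numClosedFieldType.
Implicit Types (p q : {mpoly K[3]}).

Definition aff p : {poly {poly K}} := mmap (fun c => c%:P%:P) (vec3 1 'X%:P 'X) p.

Lemma aff_is_rmorphism : exists F : {rmorphism {mpoly K[3]} -> {poly {poly K}}}, F =1 aff.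
Proof.
exists (mmap (polyC \o (@polyC K)) (vec3 1 'X%:P 'X)) => p.
by [].
Qed.

Lemma affM p q : aff (p * q) = aff p * aff q.
Proof. by have [F FE] := aff_is_rmorphism; rewrite -!FE rmorphM. Qed.

Lemma affB p q : aff (p - q) = aff p - aff q.
Proof. by have [F FE] := aff_is_rmorphism; rewrite -!FE rmorphB. Qed.

Lemma affD p q : aff (p + q) = aff p + aff q.
Proof. by have [F FE] := aff_is_rmorphism; rewrite -!FE rmorphD. Qed.

Lemma affC c : aff c%:MP = c%:P%:P.
Proof. exact: (mmapC _ (polyC \o (@polyC K))). Qed.

Lemma affX i : aff 'X_i = vec3 1 'X%:P 'X i.
Proof.
rewrite /aff -[LHS]/(mmap (polyC \o (@polyC K)) _ _).
by rewrite mmapX mmap1U.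
Qed.

Lemma aff_horner p (sg : {poly K}) t :
  (aff p).[sg].[t] = p.@[vec3 1 t sg.[t]].
Proof.
rewrite -[LHS]/((horner_eval t \o horner_eval sg)
  (mmap (polyC \o (@polyC K)) (vec3 1 'X%:P 'X) p)) rmorph_mmap.
apply: mmap_ext => [c|]; first by rewrite /= /horner_eval !hornerC.
by apply: I3P; rewrite /= !vecE /horner_eval ?hornerC ?hornerX.
Qed.

Lemma bipoly_ext (a b : {poly {poly K}}) :
  (forall t s, s != 0 -> a.[s%:P].[t] = b.[s%:P].[t]) -> a = b.
Proof.
move=> h; apply/polyP => i; apply: poly_ext_horner => t.
have : spec t a = spec t b.
  by apply: poly_ext_horner_neq0 => s s0; rewrite !spec_horner h.
by move=> /(congr1 (fun r : {poly K} => r`_i)); rewrite !coef_map.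
Qed.

Lemma vec3_eta (T : Type) (v : 'I_3 -> T) :
  v =1 vec3 (v (inord 0)) (v (inord 1)) (v (inord 2)).
Proof. by apply: I3P; rewrite vecE. Qed.

Lemma vec2_eta (T : Type) (v : 'I_2 -> T) :
  v =1 vec2 (v (inord 0)) (v (inord 1)).
Proof. by apply: I2P; rewrite vecE. Qed.

Lemma dhomog_aff d p (v : 'I_3 -> K) : p \is d.-homog -> v (inord 0) != 0 ->
  p.@[v] = v (inord 0) ^+ d *
    (aff p).[(v (inord 2) / v (inord 0))%:P].[v (inord 1) / v (inord 0)].
Proof.
move=> hp v0; rewrite aff_horner hornerC -(dhomog_scale hp).
apply: meval_eq; apply: I3P; rewrite vecE ?mulr1 // mulrC divfK //.
Qed.

(** [p] is characterized by its values off y1 = 0, and [N] is any sufficient exponent rather than a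
    degree. Surplus powers of y1 are removed later by primality of that variable. *)
Lemma homogenization_exists (a : {poly {poly K}}) :
  exists N (p : {mpoly K[3]}), forall v, v (inord 0) != 0 -> p.@[v] =
    v (inord 0) ^+ N * a.[(v (inord 2) / v (inord 0))%:P].[v (inord 1) / v (inord 0)].
Proof.
have hc (c : {poly K}) : exists N (p : {mpoly K[3]}), forall v,
    v (inord 0) != 0 -> p.@[v] = v (inord 0) ^+ N * c.[v (inord 1) / v (inord 0)].
  elim/poly_ind: c => [|c x [N [p hp]]].
    by exists 0%N, 0 => v _; rewrite meval0 horner0 mulr0.
  exists N.+1, (p * 'X_(inord 1) + x%:MP * 'X_(inord 0) ^+ N.+1) => v v0.
  rewrite mevalD !mevalM rmorphXn /= !mevalXU mevalC hp //.
  rewrite hornerD hornerM hornerX hornerC exprS; field; exact: v0.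
elim/poly_ind: a => [|a c [N [p hp]]].
  by exists 0%N, 0 => v _; rewrite meval0 !horner0 mulr0.
have [M [q hq]] := hc c.
exists (N + M.+1)%N, (p * 'X_(inord 2) * 'X_(inord 0) ^+ M
  + q * 'X_(inord 0) ^+ N.+1) => v v0.
rewrite mevalD !mevalM !rmorphXn /= !mevalXU hp // hq //.
rewrite !hornerD !hornerM hornerX !hornerC addnS !exprS exprD; field; exact: v0.
Qed.

End Affine.

Section VariableDvd.
Variables (n : nat) (R : idomainType).
Implicit Types (p q : {mpoly R[n]}) (i : 'I_n).

Lemma var_prime i p q : mdvdR 'X_i (p * q) -> mdvdR 'X_i p \/ mdvdR 'X_i q.
Proof.
apply: (@mdvd_prime _ _ (fun j => if j == i then 0 else 'X_j)).
  move=> j; case: eqP => [->|_]; first by exists 1; rewrite subr0 mul1r.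
  by exists 0; rewrite subrr mul0r.
by rewrite mmapX mmap1U eqxx.
Qed.

Lemma mpolyX_neq0 i : ('X_i : {mpoly R[n]}) != 0.
Proof.
apply/eqP => X0; have := congr1 (fun p => p@_U_(i)) X0.
by rewrite mcoeffXU eqxx mcoeff0; apply/eqP/oner_neq0.
Qed.

Lemma cancel_var i k p q (g : {mpoly R[n]}) : ~ mdvdR 'X_i g ->
  p * g = 'X_i ^+ k * q -> mdvdR g q.
Proof.
move=> ng; elim: k p => [|k IH] p e; first by exists p; rewrite e mul1r.
have : mdvdR 'X_i (p * g).
  by exists ('X_i ^+ k * q); rewrite e exprS -mulrA mulrC.
case/var_prime => // -[p' pE]; apply: (IH p').
apply: (mulfI (mpolyX_neq0 i)); rewrite [RHS]mulrA -exprS -e pE; ring.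
Qed.

End VariableDvd.

(** The prime ['X_i] is cancelled [k] times from [a] or from [b]; what remains is a factorization of
    [g], one side of which is constant. *)
Lemma irreducible_mul_var n (g : {mpoly C[n]}) i k (a b : {mpoly C[n]}) :
  mirreducible g -> a * b = 'X_i ^+ k * g ->
  exists c l, a = c%:MP * 'X_i ^+ l \/ b = c%:MP * 'X_i ^+ l.
Proof.
move=> [_ girr]; elim: k a b => [|k IH] a b e.
  have : g = a * b by rewrite e mul1r.
  case/girr => s1; [exists a@_0%MM, 0%N; left|exists b@_0%MM, 0%N; right];
    by rewrite mulr1; apply: msize1_polyC; rewrite s1.
have : mdvdR 'X_i (a * b).
  by exists ('X_i ^+ k * g); rewrite e exprS -mulrA mulrC.
case/var_prime => -[a' aE].
  have [|c [l [a'E|bE]]] := IH a' b.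
  - apply: (mulfI (mpolyX_neq0 C i)); rewrite [RHS]mulrA -exprS -e aE; ring.
  - by exists c, l.+1; left; rewrite aE a'E exprSr mulrA.
  - by exists c, l; right.
have [|c [l [bE|a'E]]] := IH a a'.
- apply: (mulfI (mpolyX_neq0 C i)); rewrite [RHS]mulrA -exprS -e aE; ring.
- by exists c, l; left.
- by exists c, l.+1; right; rewrite aE a'E exprSr mulrA.
Qed.

Lemma mulr_regroup4 (R : comNzRingType) (a b c x y : R) :
  a * x * (b * y) * c = a * b * (c * (x * y)).
Proof. ring. Qed.

Lemma mulr_regroup5 (R : comNzRingType) (a b c x y : R) :
  a * x * c * (b * y) = a * b * (c * (y * x)).
Proof. ring. Qed.

Section Homogenize.
Variable g : {mpoly C[2]}.
Hypothesis girr : mirreducible g.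
Hypothesis gdeg : (2 < msize g)%N.
Let G := homogenize g.
Let d := (msize g).-1.

Lemma g_neq0 : g != 0.
Proof. by rewrite -msize_poly_eq0; apply: contraTneq gdeg => ->. Qed.

Lemma homogenize_homog : G \is d.-homog.
Proof.
have X1 (i : 'I_3) : ('X_i : {mpoly C[3]}) \is 1.-homog by rewrite dhomogX; apply/eqP/mdeg1.
rewrite /G /homogenize big_seq.
apply: (big_ind (fun p : {mpoly C[3]} => p \is d.-homog)); first exact: dhomog0.
  by move=> p q hp hq; apply: dhomogD.
move=> m hm; have lt := msize_mdeg_lt hm; apply: dhomogZ.
have -> : d = (1 * m (inord 0) + 1 * m (inord 1) + 1 * (d - mdeg m))%N.
  rewrite !mul1n -mdeg2 subnKC // /d.
  by move: lt gdeg; rewrite -ltnS; case: (msize g).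
by apply: dhomogM; [apply: dhomogM|]; apply: dhomogMn.
Qed.

Lemma homogenize_meval a b s :
  G.@[vec3 a b s] = \sum_(m <- msupp g)
    (g@_m * (a ^+ m (inord 0) * b ^+ m (inord 1) * s ^+ (d - mdeg m)%N)).
Proof.
rewrite /G /homogenize raddf_sum; apply: eq_bigr => m _ /=.
by rewrite mevalZ !mevalM !rmorphXn /= !mevalXU !vecE.
Qed.

Lemma homogenize_at1 a b : G.@[vec3 a b 1] = g.@[vec2 a b].
Proof.
rewrite homogenize_meval mevalE; apply: eq_bigr => m _.
by rewrite expr1n mulr1 big_I2 !vecE.
Qed.

(** A line through (0:0:1) inside the curve would make [lin a b] a factor of [g], which is
    irreducible of degree at least two. *)
Lemma homogenize_line_neq0 a b : (a != 0) || (b != 0) ->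
  ~ (forall s, G.@[vec3 a b s] = 0).
Proof.
move=> ab h; have : mdvdR (lin a b) g.
  apply: lin_dvd => // s.
  rewrite -ray_horner (_ : ray _ _ = 0) ?horner0 //.
  apply: poly_ext_horner_neq0 => x x0; rewrite ray_horner horner0.
  rewrite (meval_eq (v2 := vec2 (x * a) (x * b))); last by apply: I2P; rewrite !vecE.
  rewrite -homogenize_at1.
  rewrite (meval_eq (v2 := fun i => x * vec3 a b x^-1 i)); last first.
    by apply: I3P; rewrite !vecE // mulfV.
  by rewrite (dhomog_scale homogenize_homog) h mulr0.
case=> q qE; have l0 := lin_neq0 ab; have q0 : q != 0.
  by apply: contraNneq g_neq0 => q0; rewrite qE q0 mul0r.
have sl := dhomog_msizeE l0 (lin_homog a b).
have := gdeg; rewrite [in msize g]qE msizeM // sl.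
by have [_ /(_ _ _ qE)] := girr; rewrite sl => -[->|].
Qed.

(** On y3 = 0 the form [G] restricts to the top form of [g], which is not zero. *)
Lemma homogenize_infty_neq0 : ~ (forall t, G.@[vec3 1 t 0] = 0).
Proof.
move=> h; have /eqP := g_neq0; apply.
have top : pihomog mdeg d g = 0.
  apply: (mpoly_ext_meval_neq0 (i := inord 0)) => v v0; rewrite meval0.
  have [a0] : v (inord 0) != 0 by [].
  have : G.@[fun i => v (inord 0) * vec3 1 (v (inord 1) / v (inord 0)) 0 i] = 0.
    by rewrite (dhomog_scale homogenize_homog) h mulr0.
  rewrite (meval_eq (v2 := vec3 (v (inord 0)) (v (inord 1)) 0)); last first.
    by apply: I3P; rewrite !vecE ?mulr1 ?mulr0 // mulrC divfK.
  rewrite homogenize_meval => <-.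
  rewrite pihomogE raddf_sum /= big_mkcond /= big_seq [RHS]big_seq.
  apply: eq_bigr => m hm; have := msize_mdeg_lt hm => lt.
  have le : (mdeg m <= d)%N by rewrite /d; move: lt gdeg; lia.
  rewrite expr0n subn_eq0 [X in _ = _ * (_ * (X : bool)%:R)](_ : _ = (mdeg m == d)).
    by case: eqP => _; rewrite ?mulr0 // mulr1 mevalZ mevalX big_I2.
  by rewrite eqn_leq le.
have := congr1 (mcoeff (mlead g)) top; rewrite pihomogE raddf_sum /= mcoeff0.
have hl : mdeg (mlead g) == d by rewrite /d -(mlead_deg g_neq0).
rewrite big_mkcond (bigD1_seq (mlead g)) ?msupp_uniq ?mlead_supp ?g_neq0 //= hl.
rewrite big1 => [|m nm]; last first.
  by case: ifP; rewrite // mcoeffZ mcoeffX (negbTE nm) mulr0.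
rewrite addr0 mcoeffZ mcoeffX eqxx mulr1 => /eqP.
by rewrite mleadc_eq0 => /eqP.
Qed.

(** Without y3, [aff G] would be a polynomial [q] in y2. A root t of [q] puts a whole line over
    (1:t) inside the curve; a nonzero constant [q] makes [G] a multiple of a power of y1, and the
    curve contains y1 = 0. *)
Lemma size_aff_gt1 : (1 < size (aff G))%N.
Proof.
rewrite ltnNge; apply/negP => /size1_polyC; set q := _`_0 => aE.
have GE t s : G.@[vec3 1 t s] = q.[t].
  by have := aff_horner G s%:P t; rewrite aE !hornerC => ->.
have [q1|q1] := eqVneq (size q) 1%N; last first.
  have /closed_rootP [t /rootP ht] := q1.
  apply: (@homogenize_line_neq0 1 t); first by rewrite oner_neq0.
  by move=> s; rewrite GE.
have /eqP/size_poly1P [c c0 qE] := q1.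
have GX : G = c%:MP * 'X_(inord 0) ^+ d.
  apply: (mpoly_ext_meval_neq0 (i := inord 0)) => v v0.
  rewrite (dhomog_aff homogenize_homog v0) aE hornerC qE hornerC.
  by rewrite mevalM mevalC rmorphXn /= mevalXU mulrC.
apply: (@homogenize_line_neq0 0 1); first by rewrite oner_neq0 orbT.
move=> s; rewrite GX mevalM rmorphXn /= mevalXU vecE expr0n.
have -> : (d == 0%N) = false by rewrite /d; move: gdeg; case: (msize g) => [|[|]].
by rewrite mulr0.
Qed.

Lemma spec_aff_neq0 t : spec t (aff G) != 0.
Proof.
apply/eqP => h; apply: (@homogenize_line_neq0 1 t); first by rewrite oner_neq0.
move=> s; have := aff_horner G s%:P t.
by rewrite -spec_horner h horner0 hornerC.
Qed.

(** The second hypothesis says that in the chart y3 = 1 the factor is a monomial in y1, up to a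
    power of y1. Back in the chart y1 = 1, [a] is then a constant times a power of y3, and a
    positive power would put the line y3 = 0 inside the curve. *)
Lemma monomial_factor N (p : {mpoly C[3]}) (a b : {poly {poly C}}) e c i :
  (forall v, v (inord 0) != 0 -> p.@[v] =
    v (inord 0) ^+ N * a.[(v (inord 2) / v (inord 0))%:P].[v (inord 1) / v (inord 0)]) ->
  mmap (@mpolyC 2 C) (vec3 'X_(inord 0) 'X_(inord 1) 1) p * 'X_(inord 0) ^+ e
    = c%:MP * 'X_(inord 0) ^+ i ->
  aff G = a * b -> (size a <= 1)%N.
Proof.
move=> hp e1 fE; have E : a * 'X^i = c%:P%:P * 'X^(N + e).
  apply: bipoly_ext => t s s0.
  (* The point (1:t:s) has coordinates (1/s, t/s) in the chart y3 = 1. *)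
  have := congr1 (meval (vec2 s^-1 (t / s))) e1.
  rewrite !mevalM mevalC !rmorphXn /= !mevalXU vecE.
  have -> : (mmap (@mpolyC 2 C) (vec3 'X_(inord 0) 'X_(inord 1) 1) p).@[vec2 s^-1 (t / s)]
      = p.@[vec3 s^-1 (t / s) 1].
    rewrite meval_mmap_id -[LHS]/(meval _ _) rmorph_mmap.
    apply: mmap_ext => [x|]; first by rewrite /= mevalC.
    by apply: I3P; rewrite /= !vecE ?mevalXU ?vecE ?meval1.
  rewrite hp !vecE ?invr_eq0 // invrK mul1r divfK // => h.
  rewrite !hornerM !hornerXn !hornerC -!polyC_exp !hornerC.
  move: h; set x := _.[t] => h.
  have sn k : s ^+ k != 0 by rewrite expf_neq0.
  apply: (mulfI (x := s^-1 ^+ (N + e) * s^-1 ^+ i)).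
    by rewrite mulf_neq0 // expf_neq0 // invr_eq0.
  move: h; rewrite !exprVn exprD invfM => h.
  transitivity (((s ^+ N)^-1 * x * (s ^+ e)^-1) * ((s ^+ i)^-1 * s ^+ i)); first by ring.
  rewrite h; field; rewrite !sn //.
rewrite leqNgt; apply/negP => sa.
have c0 : c != 0.
  apply: contraTneq sa => c0; move/eqP: E; rewrite c0 !polyC0 mul0r mulf_eq0.
  by rewrite expf_eq0 polyX_eq0 andbF orbF => /eqP ->; rewrite size_poly0.
have a0 : a != 0 by apply: contraTneq sa => ->; rewrite size_poly0.
have lt : (i < N + e)%N.
  have := congr1 (fun r : {poly {poly C}} => size r) E.
  rewrite size_mulXn // mul_polyC size_scale ?polyC_eq0 // size_polyXn.
  by move: sa; lia.
have aE : a = c%:P%:P * 'X^(N + e - i).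
  have xi : ('X^i : {poly {poly C}}) != 0 by rewrite expf_eq0 polyX_eq0 andbF.
  by apply: (mulIf xi); rewrite E -mulrA -exprD subnK // ltnW.
apply: homogenize_infty_neq0 => t.
have := aff_horner G 0 t; rewrite horner0 => <-.
rewrite fE aE !hornerM hornerXn expr0n subn_eq0 leqNgt lt.
by rewrite /= mulr0n horner0 mulr0 mul0r.
Qed.

(** The factors are homogenized and restricted to y3 = 1. Up to powers of y1 this is a factorization
    of [g], so one of them becomes a monomial in y1. *)
Lemma aff_irreducible (a b : {poly {poly C}}) :
  aff G = a * b -> (size a <= 1)%N \/ (size b <= 1)%N.
Proof.
move=> fE; have [N [p hp]] := homogenization_exists a.
have [M [q hq]] := homogenization_exists b.
pose r := mmap (@mpolyC 2 C) (vec3 'X_(inord 0) 'X_(inord 1) 1).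
have e1 : p * q * 'X_(inord 0) ^+ d = 'X_(inord 0) ^+ (N + M) * G.
  apply: (mpoly_ext_meval_neq0 (i := inord 0)) => v v0.
  rewrite !mevalM !rmorphXn /= mevalXU hp // hq // (dhomog_aff homogenize_homog v0).
  by rewrite fE !hornerM exprD mulr_regroup4.
have rG : r G = g.
  apply: mpoly_ext_meval => v; rewrite [RHS](meval_eq _ (vec2_eta v)).
  rewrite -homogenize_at1 /r meval_mmap_id -[LHS]/(meval _ _) rmorph_mmap.
  rewrite meval_mmap_id; apply: mmap_ext => [x|]; first by rewrite /= mevalC.
  by apply: I3P; rewrite /= !vecE ?mevalXU ?meval1.
have e2 : r p * (r q * 'X_(inord 0) ^+ d) = 'X_(inord 0) ^+ (N + M) * g.
  have rX : r 'X_(inord 0) = 'X_(inord 0) by rewrite /r mmapX mmap1U vecE.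
  have := congr1 r e1; rewrite /r !rmorphM !rmorphXn /= -!/(r _) rX rG => <-.
  by rewrite mulrA.
have [c [i [h|h]]] := irreducible_mul_var girr e2.
  left; apply: (@monomial_factor N p a b 0 c i hp) => //.
  by rewrite mulr1.
right; apply: (@monomial_factor M q b a d c i hq) => //.
by rewrite fE mulrC.
Qed.

Lemma aff_dvd_mdvd D (z : {mpoly C[3]}) (w : {poly {poly C}}) : z \is D.-homog ->
  aff z = aff G * w -> mdvd G z.
Proof.
move=> hz zE; have [N [p hp]] := homogenization_exists w.
have e1 : (p * 'X_(inord 0) ^+ D) * G = 'X_(inord 0) ^+ (N + d) * z.
  apply: (mpoly_ext_meval_neq0 (i := inord 0)) => v v0.
  rewrite !mevalM !rmorphXn /= mevalXU hp // (dhomog_aff homogenize_homog v0).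
  by rewrite (dhomog_aff hz v0) zE !hornerM exprD mulr_regroup5.
apply: cancel_var e1 => -[q qE].
apply: (@homogenize_line_neq0 0 1); first by rewrite oner_neq0 orbT.
by move=> s; rewrite -/G qE mevalM mevalXU vecE mulr0.
Qed.

Lemma msize_homogenize : (1 < msize G)%N.
Proof.
rewrite ltnNge; apply/negP => /msize1_polyC GE.
by have := size_aff_gt1; rewrite GE affC size_polyC; case: (_ == _).
Qed.

Lemma aff_coprime D (z : {mpoly C[3]}) : z \is D.-homog ->
  ~ common_component z G -> (size (gcdp (aff G) (aff z)) <= 1)%N.
Proof.
move=> hz nc; rewrite leqNgt; apply/negP => sg.
have f0 : aff G != 0 by rewrite -size_poly_gt0 ltnW // size_aff_gt1.
have [w zE] := irreducible_dvd_of_gcd f0 aff_irreducible spec_aff_neq0 sg.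
apply: nc; exists G; split; first exact: msize_homogenize.
by split; [apply: aff_dvd_mdvd hz zE | exists 1; rewrite mul1r].
Qed.

(** By irreducibility a common factor makes [aff G] divide its derivative, which is nonzero in
    characteristic zero and of smaller degree. *)
Lemma aff_separable : (size (gcdp (aff G) (aff G)^`()) <= 1)%N.
Proof.
rewrite leqNgt; apply/negP => sg; have s1 := size_aff_gt1.
have f0 : aff G != 0 by rewrite -size_poly_gt0 ltnW.
have [w dE] := irreducible_dvd_of_gcd f0 aff_irreducible spec_aff_neq0 sg.
have d0 : (aff G)^`() != 0.
  apply/eqP => d0; have := congr1 (fun r : {poly {poly C}} => r`_(size (aff G)).-2) d0.
  rewrite coef_deriv coef0 => /(congr1 (fun r : {poly C} => r`_(size (lead_coef (aff G))).-1)).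
  rewrite coefMn coef0 => /eqP; rewrite mulrn_eq0.
  rewrite (_ : (size (aff G)).-2.+1 = (size (aff G)).-1); last by lia.
  rewrite -[_`_(size (aff G)).-1]/(lead_coef _) -[_`_(size _).-1]/(lead_coef _).
  rewrite !lead_coef_eq0 (negbTE f0) orbF; apply/negP; lia.
have := lt_size_deriv f0; rewrite dE size_mul //; last first.
  by apply: contraNneq d0 => w0; rewrite dE w0 mulr0.
have : (0 < size w)%N.
  by rewrite size_poly_gt0; apply: contraNneq d0 => w0; rewrite dE w0 mulr0.
move: (size (aff G)) (size w) s1 => i j; lia.
Qed.

End Homogenize.

(** * The resultant with respect to the third variable *)

Definition psi (w : 'I_2 -> C) : A -> {poly C} :=
  mmap (@deh C) (fun j => (w j)%:P).

HB.instance Definition _ w := GRing.RMorphism.copy (psi w)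
  (mmap (@deh C) (fun j => (w j)%:P)).

Definition evA (y w : 'I_2 -> C) : A -> C := mmap (meval y) w.

HB.instance Definition _ y w := GRing.RMorphism.copy (evA y w) (mmap (meval y) w).

Lemma psi_horner w R t : (psi w R).[t] = evA (vec2 1 t) w R.
Proof.
rewrite -[LHS]/(horner_eval t _) rmorph_mmap.
by apply: mmap_ext => [p|j]; rewrite /= /horner_eval ?deh_horner ?hornerC.
Qed.

Lemma evA_C y w p : evA y w (p%:MP_[2]) = p.@[y].
Proof. exact: mmapC. Qed.

Lemma evA_X y w j : evA y w 'X_j = w j.
Proof. by rewrite /evA mmapX mmap1U. Qed.

Lemma evA_eq y y' w R : y =1 y' -> evA y w R = evA y' w R.
Proof. by move=> h; apply: mmap_ext => // p; apply: meval_eq. Qed.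

Lemma toY3_evA y w p s : (map_poly (evA y w) (toY3 p)).[s] =
  p.@[vec3 (y (inord 0)) (y (inord 1)) s].
Proof.
pose f := @polyC A \o @mpolyC 2 {mpoly C[2]} \o @mpolyC 2 C.
pose h := fun i : 'I_3 => if i == inord 2 then 'X
  else ((('X_(inord i) : {mpoly C[2]})%:MP_[2]) : A)%:P.
rewrite -[LHS]/((horner_eval s \o map_poly (evA y w)) (mmap f h p)) rmorph_mmap.
apply: mmap_ext => [c|].
  by rewrite /= map_polyC /horner_eval hornerC /= evA_C mevalC.
apply: I3P; rewrite /= /h !inord_eq //= ?vecE.
- by rewrite inordK // map_polyC /horner_eval hornerC /= evA_C mevalXU.
- by rewrite inordK // map_polyC /horner_eval hornerC /= evA_C mevalXU.
- by rewrite map_polyX /horner_eval hornerX.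
Qed.

Lemma toY3_is_rmorphism :
  exists F : {rmorphism {mpoly C[3]} -> {poly A}}, F =1 toY3.
Proof.
exists (mmap (@polyC A \o @mpolyC 2 {mpoly C[2]} \o @mpolyC 2 C)
  (fun i : 'I_3 => if i == inord 2 then 'X
    else ((('X_(inord i) : {mpoly C[2]})%:MP_[2]) : A)%:P)).
by [].
Qed.

Lemma toY3u_evA y w Z s : (map_poly (evA y w) (toY3u Z)).[s] =
  (specialize Z w).@[vec3 (y (inord 0)) (y (inord 1)) s].
Proof.
have [T TE] := toY3_is_rmorphism.
have -> : toY3u Z = mmap T (fun j : 'I_2 => ('X_j : A)%:P) Z.
  by apply: mmap_ext => // p; rewrite TE.
rewrite /specialize meval_specialize -[LHS]/((horner_eval s \o map_poly (evA y w)) _) rmorph_mmap.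
apply: mmap_ext => [p|j]; first by rewrite /= TE -(toY3_evA y w).
by rewrite /= map_polyC /horner_eval hornerC /= evA_X.
Qed.

Lemma psi_bihorner w (P : {poly A}) s t :
  (map_poly (psi w) P).[s%:P].[t] = (map_poly (evA (vec2 1 t) w) P).[s].
Proof.
rewrite -spec_horner; congr (_.[s]); apply/polyP => i.
by rewrite !coef_map /= -psi_horner.
Qed.

Lemma psi_toY3 w p : map_poly (psi w) (toY3 p) = aff p.
Proof.
apply: bipoly_ext => t s _.
by rewrite psi_bihorner toY3_evA aff_horner hornerC !vecE.
Qed.

Lemma psi_toY3u w Z : map_poly (psi w) (toY3u Z) = aff (specialize Z w).
Proof.
apply: bipoly_ext => t s _.
by rewrite psi_bihorner toY3u_evA aff_horner hornerC !vecE.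
Qed.

(* A polynomial in y3 that is homogeneous of degree d in (y1,y2,y3). *)
Definition weighted (d : nat) (P : {poly A}) := forall (x : C) y w k, x != 0 ->
  x ^+ k * evA (fun i => x * y i) w P`_k = x ^+ d * evA y w P`_k.

Lemma weightedP d (P : {poly A}) :
  (forall x y w s, x != 0 ->
    (map_poly (evA (fun i => x * y i) w) P).[x * s] =
      x ^+ d * (map_poly (evA y w) P).[s]) -> weighted d P.
Proof.
move=> h x y w k x0.
pose p1 := map_poly (evA (fun i => x * y i) w) P.
pose p2 := map_poly (evA y w) P.
have e : \poly_(i < size p1) (x ^+ i * p1`_i) = x ^+ d *: p2.
  apply: poly_ext_horner => s; rewrite hornerZ -h // horner_poly horner_coef.
  by apply: eq_bigr => i _; rewrite exprMn mulrCA mulrA [x ^+ i * _]mulrC.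
have := congr1 (fun r : {poly C} => r`_k) e.
rewrite coefZ coef_poly [p2`_k](coef_map (evA y w)) /= => <-.
case: ltnP => [_|le]; first by rewrite /p1 coef_map.
by rewrite -[evA _ w P`_k](coef_map (evA _ w)) nth_default // mulr0.
Qed.

Lemma weighted_toY3 d p : p \is d.-homog -> weighted d (toY3 p).
Proof.
move=> hp; apply: weightedP => x y w s x0; rewrite !toY3_evA.
rewrite -(dhomog_scale hp); apply: meval_eq; apply: I3P; rewrite !vecE //.
Qed.

Lemma specialize_homog d (Z : {mpoly {mpoly C[3]}[2]}) w :
  (forall m, Z@_m \is d.-homog) -> specialize Z w \is d.-homog.
Proof.
move=> hZ; rewrite /specialize mevalE.
apply: (big_ind (fun p : {mpoly C[3]} => p \is d.-homog)); first exact: dhomog0.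
  by move=> p q hp hq; apply: dhomogD.
move=> m _; rewrite (eq_bigr (fun i => ((w i ^+ m i)%:MP_[3]))) => [|i _].
  by rewrite -rmorph_prod mulrC mul_mpolyC; apply: dhomogZ.
by rewrite rmorphXn.
Qed.

Lemma weighted_toY3u d Z : (forall m, Z@_m \is d.-homog) -> weighted d (toY3u Z).
Proof.
move=> hZ; apply: weightedP => x y w s x0; rewrite !toY3u_evA.
rewrite -(dhomog_scale (specialize_homog w hZ)).
by apply: meval_eq; apply: I3P; rewrite !vecE.
Qed.

(* Entry (i,j) of the Sylvester matrix is homogeneous of degree a_i - j. *)
Lemma resultant_weighted d e (P Q : {poly A}) : weighted d P -> weighted e Q ->
  exists k l, forall (x : C) y w, x != 0 ->
    x ^+ k * evA (fun i => x * y i) w (resultant P Q) =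
    x ^+ l * evA y w (resultant P Q).
Proof.
move=> hP hQ; set S := Sylvester_mx P Q.
pose a (i : 'I_((size Q).-1 + (size P).-1)) :=
  match split i with inl k => (d + k)%N | inr k => (e + k)%N end.
exists (\sum_(j < (size Q).-1 + (size P).-1) j)%N, (\sum_i a i)%N => x y w x0.
have E : map_mx (evA (fun i => x * y i) w) S *m diag_mx (\row_j x ^+ j) =
    diag_mx (\row_i x ^+ a i) *m map_mx (evA y w) S.
  apply/matrixP => i j; rewrite mul_mx_diag mul_diag_mx mxE [RHS]mxE.
  have SE v : map_mx (evA v w) S i j = evA v w (match split i with
      | inl k => P`_(j - k) *+ (k <= j) | inr k => Q`_(j - k) *+ (k <= j) end).
    by rewrite mxE Sylvester_mxE.
  rewrite !SE ![(\row__ _) _ _]mxE /a; case: (split i) => k; case: leqP => [le|_];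
    rewrite ?mulr0n ?raddf0 ?mul0r ?mulr0 // mulr1n mulrC -{1}(subnK le).
    by rewrite exprD [_ * x ^+ k]mulrC -mulrA hP // mulrA [x ^+ k * _]mulrC -exprD.
  by rewrite exprD [_ * x ^+ k]mulrC -mulrA hQ // mulrA [x ^+ k * _]mulrC -exprD.
have prE (n : nat) (b : 'I_n -> nat) : \prod_i (\row_i x ^+ b i) 0 i = x ^+ (\sum_i b i)%N.
  by rewrite -prodrXr; apply: eq_bigr => i _; rewrite mxE.
have := congr1 determinant E; rewrite !det_mulmx !det_diag !det_map_mx !prE.
by rewrite mulrC.
Qed.

Lemma resultant_formcoef d e (P Q : {poly A}) : weighted d P -> weighted e Q ->
  exists n, formcoef n (resultant P Q).
Proof.
move=> hP hQ; have [k [l h]] := resultant_weighted hP hQ.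
exists (l - k)%N => m; apply/dhomogP => mm hmm.
rewrite -[l](scale_dhomog (r := 1) (k := k) (oner_neq0 _) _ hmm) ?addKn //.
move=> x v x0; rewrite meval1 !mulr1.
by apply: mpoly2_eq_coef => w; apply: h.
Qed.

(** The leading coefficient in y3 is homogeneous in (y1, y2), so setting y1 = 1 cannot kill it. The
    degree of [G] that enters the resultant is thus the one seen in the chart. *)
Lemma size_aff_toY3 d p : p \is d.-homog -> size (aff p) = size (toY3 p).
Proof.
move=> hp; rewrite -(psi_toY3 (fun=> 0)).
have [P0|P0] := eqVneq (toY3 p) 0; first by rewrite P0 map_poly0 !size_poly0.
apply: size_map_poly_id0; apply: contraNneq P0 => l0.
rewrite -lead_coef_eq0; apply/eqP; set k := (size (toY3 p)).-1.
apply: (@mpoly2_eq0 _ _ _ _ (inord 0)) => y w y0.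
rewrite -[LHS]/(evA y w (toY3 p)`_k).
have l0' : psi w (toY3 p)`_k = 0.
  by rewrite -l0 /lead_coef -!coef_map /= !psi_toY3.
have := weighted_toY3 hp (vec2 1 (y (inord 1) / y (inord 0))) w k y0.
rewrite -psi_horner l0' horner0 mulr0 => /eqP.
rewrite mulf_eq0 expf_eq0 (negbTE y0) andbF /= => /eqP h; rewrite -[RHS]h.
by apply: evA_eq; apply: I2P; rewrite !vecE ?mulr1 // mulrC divfK.
Qed.

Lemma lead_aff d p : p \is d.-homog -> forall w,
  psi w (lead_coef (toY3 p)) = lead_coef (aff p).
Proof.
move=> hp w; rewrite /lead_coef (size_aff_toY3 hp) -(psi_toY3 w).
by rewrite coef_map.
Qed.

(* If both restrictions to the arc y3 = sg(y2) vanished to order 2, the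
   uniformizer y2 - t, which lies in the local ideal (F,H), would vanish too. *)
Lemma imult1_transversal (F H : {mpoly C[3]}) t s (sg e e' : {poly C}) :
  imult_eq F H (vec3 1 t s) 1 -> F.@[vec3 1 t s] = 0 -> H.@[vec3 1 t s] = 0 ->
  sg.[t] = s -> (aff F).[sg] = ('X - t%:P) ^+ 2 * e ->
  (aff H).[sg] = ('X - t%:P) ^+ 2 * e' -> False.
Proof.
set p := vec3 1 t s => -[bs [gen _]] Fp Hp sgt Fe He.
have chE : chart p = inord 0 by rewrite /chart /p vecE oner_neq0.
have p0 : p (inord 0) = 1 by rewrite /p vecE.
have p1 : p (inord 1) = t by rewrite /p vecE.
have loc0 h : loc_ideal F H p h -> h.@[p] = 0.
  move=> [u [a [b [c [u0 E]]]]]; have := congr1 (meval p) E.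
  rewrite !mevalD !mevalM Fp Hp chE mevalB mevalXU meval1 p0 subrr.
  by rewrite !mulr0 !addr0 => /eqP; rewrite mulf_eq0 (negbTE u0) => /eqP.
(* Multiplicity one makes 1 and y2 - t multiples of a single generator modulo the local ideal.
   Evaluating at [p] shows that this generator is nonzero there and that the multiple for y2 - t is
   zero. *)
have [lam l1] := gen 1; have [mu l2] := gen ('X_(inord 1) - t%:MP).
rewrite !big_ord1 in l1 l2.
have := loc0 _ l1; have := loc0 _ l2.
rewrite !mevalB !mevalZ mevalXU meval1 mevalC p1 subrr sub0r.
move=> /eqP; rewrite oppr_eq0 mulf_eq0 => mu0 /eqP; rewrite subr_eq0 => /eqP lb.
have m0 : mu 0 = 0.
  apply/eqP; case/orP: mu0 => // /eqP b0.
  by move: lb; rewrite b0 mulr0 => /eqP; rewrite oner_eq0.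
rewrite m0 scale0r subr0 in l2.
have [u [a [b [c [u0 E]]]]] := l2; rewrite chE in E.
have := congr1 (fun r => (aff r).[sg]) E.
rewrite !affD !affM !affB !affX affC !vecE.
have -> : aff 1 = 1 :> {poly {poly C}} by rewrite -mpolyC1 affC !polyC1.
rewrite subrr mulr0 addr0 !hornerD !hornerM hornerD hornerN !hornerC Fe He => h.
(* After one factor X - t is cancelled, [u] restricted to the arc is still divisible by X - t,
   although [u] is nonzero at [p]. *)
have h' : (aff u).[sg] * ('X - t%:P) =
    ((aff a).[sg] * e * ('X - t%:P) + (aff b).[sg] * e' * ('X - t%:P)) * ('X - t%:P).
  rewrite h; move: ((aff a).[sg]) ((aff b).[sg]) ('X - t%:P) => x1 x2 x3.
  by rewrite mulrDl !expr2 -!mulrA ![x3 * (x3 * _)]mulrA ![x3 * x3 * _]mulrC.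
move/mulIf: h' => /(_ (negbT (polyXsubC_eq0 t))) h'.
case/negP: u0; rewrite /p -sgt -aff_horner h' hornerD !hornerM hornerXsubC.
by rewrite subrr !mulr0 addr0.
Qed.

(** * Multiplicities of the roots of the resultant *)

Section Roots.
Variable K : numClosedFieldType.
Implicit Types (p : {poly K}).

Definition roots_of p : seq K := sval (closed_field_poly_normal p).

Lemma roots_ofE p : p = lead_coef p *: \prod_(r <- roots_of p) ('X - r%:P).
Proof. exact: (svalP (closed_field_poly_normal p)). Qed.

Lemma size_roots_of p : p != 0 -> size (roots_of p) = (size p).-1.
Proof.
move=> p0; rewrite [in RHS](roots_ofE p) size_scale ?lead_coef_eq0 //.
by rewrite size_prod_XsubC.
Qed.

Lemma mem_roots_of p x : p != 0 -> (x \in roots_of p) = root p x.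
Proof.
move=> p0; rewrite [in RHS](roots_ofE p) rootZ ?lead_coef_eq0 //.
by rewrite root_prod_XsubC.
Qed.

Lemma mup_roots_of p x : p != 0 -> mup x p = count_mem x (roots_of p).
Proof.
move=> p0; rewrite [in LHS](roots_ofE p) -mul_polyC mupMr; first by rewrite mu_prod_XsubC.
by rewrite rootC lead_coef_eq0.
Qed.

Lemma uniq_roots_of p : p != 0 -> (forall x, root p x -> ~~ root p^`() x) ->
  uniq (roots_of p).
Proof.
move=> p0 h; apply: count_mem_uniq => x.
rewrite -mup_roots_of // mem_roots_of //.
have [rx|nr] := boolP (root p x); last by rewrite mupNroot.
apply/eqP; rewrite eqn_leq mup_leq // mup_geq // expr1 dvdp_XsubCl rx andbT.
apply: contra (h x rx) => /dvdpP [q ->].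
rewrite expr2 mulrA derivM derivXsubC mulr1 /root hornerD !hornerM hornerXsubC.
by rewrite subrr !mulr0 addr0.
Qed.

End Roots.

Lemma mup_resultant_count d (F : {mpoly C[3]}) (Z : {mpoly {mpoly C[3]}[2]}) w t :
  F \is d.-homog -> (lead_coef (aff F)).[t] != 0 ->
  (forall s, (aff F).[s%:P].[t] = 0 -> (aff F)^`().[s%:P].[t] != 0) ->
  (forall s, (aff F).[s%:P].[t] = 0 -> (aff (specialize Z w)).[s%:P].[t] = 0 ->
     imult_eq F (specialize Z w) (vec3 1 t s) 1) ->
  [/\ psi w (res_y3 F Z) != 0,
      uniq (roots_of (spec t (aff F)))
    & mup t (psi w (res_y3 F Z)) =
      size [seq s <- roots_of (spec t (aff F))
             | (aff (specialize Z w)).[s%:P].[t] == 0]].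
Proof.
move=> hF lc sep him; set f := aff F in lc sep him *.
set z := aff (specialize Z w) in him *; set rs := roots_of _.
have szp : size (spec t f) = size f by rewrite size_map_poly_id0.
have f0 : f != 0 by apply: contraNneq lc => ->; rewrite lead_coef0 horner0.
have p0 : spec t f != 0 by rewrite -size_poly_eq0 szp size_poly_eq0.
have urs : uniq rs.
  apply: uniq_roots_of => // x; rewrite /root spec_horner => /eqP /sep.
  by rewrite /spec deriv_map -/(spec t _) spec_horner.
have rsE s : s \in rs -> f.[s%:P].[t] = 0.
  by rewrite mem_roots_of // => /rootP; rewrite spec_horner.
have szrs : size rs = (size (toY3 F)).-1.
  by rewrite size_roots_of // szp /f (size_aff_toY3 hF).
pose sv (i : 'I_(size (toY3 F)).-1) := nth 0 rs i.
have sv_in i : sv i \in rs by rewrite mem_nth // szrs.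
pose b i := z.[(sv i)%:P].[t] == 0.
(* The triple holds the lift of the root, the cofactor of [f] along it, and the value of [z] along
   it, freed of one factor X - t when the root is a common zero. *)
have /fin_all_exists [u hu] i : exists u : {poly C} * {poly C} * {poly C},
    [/\ (u.1.1).[t] = sv i, f.[u.1.1] = ('X - t%:P) ^+ 2 * u.1.2,
        z.[u.1.1] = ('X - t%:P) ^+ b i * u.2 & u.2.[t] != 0].
  have fs := rsE _ (sv_in i).
  have [x [e fE]] := first_order_lift fs (sep _ fs).
  set sg := _ + _ in fE.
  have sgt : sg.[t] = sv i.
    by rewrite /sg hornerD hornerM hornerXsubC !hornerC subrr mulr0 addr0.
  have zt : z.[sg].[t] = z.[(sv i)%:P].[t] by rewrite !aff_horner sgt hornerC.
  rewrite /b; case: eqP => [z0|/eqP z0]; last first.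
    by exists (sg, e, z.[sg]); split; rewrite //= ?expr0 ?mul1r // zt.
  have /rootP /factor_theorem [q qE] : z.[sg].[t] = 0 by rewrite zt.
  exists (sg, e, q); split; rewrite //= ?expr1 1?mulrC //.
  apply/eqP => /rootP /factor_theorem [q' q'E].
  apply: (@imult1_transversal F (specialize Z w) t (sv i) sg e q') => //.
  - by apply: him.
  - by rewrite -fs aff_horner hornerC.
  - by rewrite -z0 aff_horner hornerC.
  - by rewrite -/z qE q'E -mulrA -expr2 mulrC.
have inj : injective (fun i => (u i).1.1.[t]).
  move=> i j; have [-> _ _ _] := hu i; have [-> _ _ _] := hu j => /eqP.
  by rewrite nth_uniq ?szrs // => /eqP /val_inj.
have [|i|i|i|r0 mu] := @mup_resultant C A (psi w) (toY3 F) (toY3u Z) t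
    (fun i => (u i).1.1) (fun i => (u i).1.2) (fun i => (u i).2) b inj.
- by rewrite /= (lead_aff hF).
- by rewrite psi_toY3; have [] := hu i.
- by rewrite psi_toY3u; have [] := hu i.
- by have [] := hu i.
split=> //; rewrite [LHS]mu size_filter -sum1_count (big_nth 0) szrs.
by rewrite big_mkord [RHS]big_mkcond; apply: eq_bigr => i _; rewrite /b /sv; case: (_ == _).
Qed.

(** * Counting the intersection points *)

Lemma psi_form_size n (h : A) w : formcoef n h -> (size (psi w h) <= n.+1)%N.
Proof.
move=> hh; rewrite /psi /mmap; apply: (leq_trans (size_sum _ _ _)).
apply/bigmax_leqP_seq => m _ _.
have -> : mmap1 (fun j => (w j)%:P) m = (mmap1 w m)%:P.
  by rewrite /mmap1 rmorph_prod; apply: eq_bigr => i _; rewrite rmorphXn.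
rewrite mulrC mul_polyC (leq_trans (size_scale_leq _ _)) //.
exact: size_deh (hh m).
Qed.

(** Nonvanishing on the line (0:1) therefore means that no root escapes to infinity and the degree
    is exactly [n]. *)
Lemma psi_form_top n (h : A) w : formcoef n h ->
  (psi w h)`_n = evA (vec2 0 1) w h.
Proof.
move=> hh; rewrite /psi /evA /mmap coef_sum; apply: eq_bigr => m _.
have -> : mmap1 (fun j => (w j)%:P) m = (mmap1 w m)%:P.
  by rewrite /mmap1 rmorph_prod; apply: eq_bigr => i _; rewrite rmorphXn.
by rewrite coefMC (deh_top (hh m)).
Qed.

Lemma ydeg_form n (h : A) : h != 0 -> formcoef n h -> ydeg h = n.
Proof.
move=> h0 hh; have E m : m \in msupp h -> (msize h@_m).-1 = n.
  by rewrite mcoeff_msupp => hm; rewrite (dhomog_msizeE hm (hh m)).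
apply/eqP; rewrite eqn_leq /ydeg; apply/andP; split.
  by apply/bigmax_leqP_seq => m hm _; rewrite E.
have hl := mlead_supp h0; rewrite -{1}(E _ hl).
exact: (@leq_bigmax_seq _ _ xpredT (fun m => (msize h@_m).-1)).
Qed.

Lemma psiZ w c (h : A) : psi w (c *: h) = deh c * psi w h.
Proof. exact: (mmapZ _ (@deh C)). Qed.

Lemma generic_all (T : eqType) (l : seq T) (P : T -> ('I_2 -> C) -> Prop) :
  (forall x, x \in l -> exists2 q : {mpoly C[2]}, q != 0 &
     forall w, q.@[w] != 0 -> P x w) ->
  exists2 q : {mpoly C[2]}, q != 0 &
    forall w, q.@[w] != 0 -> forall x, x \in l -> P x w.
Proof.
elim: l => [|x l IH] h; first by exists 1; rewrite ?oner_neq0.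
have [|q q0 hq] := IH; first by move=> y yl; apply: h; rewrite in_cons yl orbT.
have [q' q'0 hq'] := h x (mem_head _ _).
exists (q' * q) => [|w]; first by rewrite mulf_neq0.
rewrite mevalM mulf_eq0 negb_or => /andP[w1 w2] y.
by rewrite in_cons => /orP[/eqP ->|yl]; [apply: hq' | apply: hq].
Qed.

Lemma zopen_setI (U : ('I_2 -> C) -> Prop) (q : {mpoly C[2]}) : zopen U ->
  (exists w, U w) -> q != 0 ->
  zopen (fun w => U w /\ q.@[w] != 0) /\ (exists w, U w /\ q.@[w] != 0).
Proof.
move=> [s hs] [w0 /hs /hasP [f fs fw0]] q0; split.
  exists [seq f * q | f <- s] => w; rewrite has_map; split.
    move=> [/hs /hasP [f' f's f'w] qw]; apply/hasP; exists f' => //=.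
    by rewrite mevalM mulf_neq0.
  move=> /hasP [f' f's /=]; rewrite mevalM mulf_eq0 negb_or => /andP[f'w qw].
  by split=> //; apply/hs/hasP; exists f'.
have f0 : f != 0 by apply: contraNneq fw0 => ->; rewrite meval0.
apply: NNPP => hn; apply: (meval_neq0 (mulf_neq0 f0 q0)) => w.
apply/eqP; apply: contraT; rewrite mevalM mulf_eq0 negb_or => /andP[fw qw].
by case: hn; exists w; split=> //; apply/hs/hasP; exists f.
Qed.

Lemma map_meval_neq0 (n : nat) (h : {mpoly {mpoly C[n]}[2]}) (y : 'I_n -> C) m :
  (h@_m).@[y] != 0 -> map_mpoly (meval y) h != 0.
Proof.
by apply: contraNneq => e; rewrite -mcoeff_map_mpoly e mcoeff0.
Qed.

Lemma sum_count_undup (T : eqType) (r : seq T) :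
  (\sum_(x <- undup r) count_mem x r)%N = size r.
Proof.
rewrite -[RHS]count_predT -[RHS]sum1_count -[RHS]big_undup_iterop_count.
by apply: eq_bigr => x _; rewrite Monoid.iteropE iter_addn_0 mul1n.
Qed.

Lemma vec3_inj (T : Type) (a b c a' b' c' : T) :
  vec3 a b c = vec3 a' b' c' -> [/\ a = a', b = b' & c = c'].
Proof.
move=> e; split.
- by have := congr1 (fun f => f (inord 0)) e; rewrite !vecE.
- by have := congr1 (fun f => f (inord 1)) e; rewrite !vecE.
- by have := congr1 (fun f => f (inord 2)) e; rewrite !vecE.
Qed.

Lemma pt_vec3 (p : pt) : p = vec3 (p (inord 0)) (p (inord 1)) (p (inord 2)).
Proof. by apply: functional_extensionality; apply: vec3_eta. Qed.

Lemma normalizedP (p : pt) : normalized p ->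
  [\/ exists t s, p = vec3 1 t s, exists s, p = vec3 0 1 s | p = pt001].
Proof.
rewrite /normalized /chart; have pE := pt_vec3 p.
case: eqP => [p0|_] /= p1; last first.
  by constructor 1; exists (p (inord 1)), (p (inord 2)); rewrite {1}pE p1.
case: eqP p1 => [p1|_] /= p2; last first.
  by constructor 2; exists (p (inord 2)); rewrite {1}pE p0 p2.
constructor 3; apply: functional_extensionality; rewrite pE p0 p1 p2.
by apply: I3P; rewrite /pt001 !vecE !inord_eq.
Qed.

Lemma normalized_vec3_1 (t s : C) : normalized (vec3 1 t s).
Proof. by rewrite /normalized /chart !vecE oner_neq0 vecE. Qed.

Lemma normalized_vec3_01 (s : C) : normalized (vec3 0 1 s).
Proof. by rewrite /normalized /chart !vecE eqxx oner_neq0 /= vecE. Qed.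

Definition fiber (G : {mpoly C[3]}) a b : {poly C} :=
  mmap polyC (vec3 a%:P b%:P 'X) G.

Lemma fiber_horner G a b s : (fiber G a b).[s] = G.@[vec3 a b s].
Proof.
rewrite -[LHS]/(horner_eval s _) rmorph_mmap.
apply: mmap_ext => [c|]; first by rewrite /= /horner_eval hornerC.
by apply: I3P; rewrite /= !vecE /horner_eval ?hornerC ?hornerX.
Qed.

Lemma specialize_meval Z w p :
  (specialize Z w).@[p] = (map_mpoly (meval p) Z).@[w].
Proof. by rewrite /specialize meval_specialize mmap_meval_map. Qed.

Theorem mainTheorem6
  (g : {mpoly C[2]})                    (* affine curve D = {g = 0} in C^2 *)
  (Z : {mpoly {mpoly C[3]}[2]})         (* Z(y1,y2,y3,u1,u2) *)
  (Xi : ('I_2 -> C) -> Prop)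
  (* D irreducible and not a line *)
  (Hg_irr : mirreducible g)
  (Hg_deg : (2 < msize g)%N)
  (* Z homogeneous in y and depending on y3 *)
  (HZhom : exists d : nat, forall m, Z@_m \is d.-homog)
  (HZy3 : exists m mm, mm \in msupp (Z@_m) /\ (0 < mm (inord 2))%N)
  (* Xi non-empty Zariski open *)
  (HXi_open : zopen Xi) (HXi_ne : exists w, Xi w) :
  let G := homogenize g in
  let inGG (p : pt) :=
    forall u, Xi u -> on_curve (specialize Z u) p /\ on_curve G p in
  (forall w, Xi w ->
     (* (1) *)
     msize (specialize Z w) = (ydeg3 Z).+1 /\
     (* (2) *)
     ~ common_component (specialize Z w) G /\
     (* (3) *)
     (forall p, normalized p -> on_curve (specialize Z w) p -> on_curve G p ->
        ~ inGG p -> imult_eq G (specialize Z w) p 1) /\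
     (* (4) *)
     (forall p, normalized p -> on_curve G p ->
        (forall m, on_curve (Z@_m) p) -> inGG p) /\
     (* (5) *)
     ~ (on_curve (specialize Z w) pt001 /\ on_curve G pt001 /\ ~ inGG pt001)) ->
  exists Xs : ('I_2 -> C) -> Prop,
    zopen Xs /\ (exists w, Xs w) /\ (forall w, Xs w -> Xi w) /\
    exists n : nat, pp_ydeg (res_y3 G Z) n /\
      forall w, Xs w ->
        card_is (fun p => normalized p /\ on_curve (specialize Z w) p /\
                          on_curve G p /\ ~ inGG p) n.
Proof.
move=> G inGG H; have [w0 Xi0] := HXi_ne; have [D hZ] := HZhom.
have hG := homogenize_homog Hg_deg; rewrite -/G in hG.
set f := aff G; have sf : (1 < size f)%N := size_aff_gt1 Hg_irr Hg_deg.
have f0 : f != 0 by rewrite -size_poly_gt0 ltnW.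
have [_ [nc0 [_ [H4 _]]]] := H w0 Xi0.
(* [c1] vanishes where the fibre of the curve has a multiple root, [c2] below every common point of
   the curve and Z(w0) in the chart. Since GG lies on Z(w0), this one choice bounds GG for all w. *)
have [u1 [v1 [c1 [c10 bez1]]]] := coprime_bezout f0 (aff_separable Hg_irr Hg_deg).
have [u2 [v2 [c2 [c20 bez2]]]] := coprime_bezout f0
  (aff_coprime Hg_irr Hg_deg (specialize_homog w0 hZ) nc0).
have lc0 : lead_coef f != 0 by rewrite lead_coef_eq0.
have sep t s : c1.[t] != 0 -> f.[s%:P].[t] = 0 -> f^`().[s%:P].[t] != 0.
  move=> c1t ft; apply: contraNneq c1t => f't.
  have := congr1 (fun r => r.[s%:P].[t]) bez1.
  by rewrite /= hornerD !hornerM hornerC hornerD !hornerM -/f ft f't !mulr0 addr0 => <-.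
have GGbad t s : inGG (vec3 1 t s) -> c2.[t] = 0.
  move=> /(_ w0 Xi0) [z0 g0]; have := congr1 (fun r => r.[s%:P].[t]) bez2.
  rewrite /= hornerD !hornerM hornerC hornerD !hornerM !aff_horner !hornerC.
  by rewrite z0 g0 !mulr0 addr0 => <-.
set R := res_y3 G Z.
have count w t : Xi w -> c1.[t] != 0 -> c2.[t] != 0 -> (lead_coef f).[t] != 0 ->
  [/\ psi w R != 0, uniq (roots_of (spec t f)) & mup t (psi w R) =
      size [seq s <- roots_of (spec t f) | (aff (specialize Z w)).[s%:P].[t] == 0]].
  move=> Xiw c1t c2t lct; apply: mup_resultant_count hG lct _ _; first by move=> s; apply: sep.
  move=> s fs zs; have [_ [_ [H3 _]]] := H w Xiw.
  apply: H3; first exact: normalized_vec3_1.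
  - by rewrite /on_curve -zs aff_horner hornerC.
  - by rewrite /on_curve -fs aff_horner hornerC.
  - by move/GGbad/eqP; rewrite (negbTE c2t).
(* A single good t suffices: the multiplicity count there includes that the resultant at [w0] is not
   zero. *)
have psi0 : psi w0 R != 0.
  have q0 : c1 * c2 * lead_coef f != 0 by rewrite !mulf_neq0.
  have [t] : exists t, (c1 * c2 * lead_coef f).[t] != 0.
    apply: NNPP => hn; case/eqP: q0; apply: poly_eq0_horner => t.
    by apply/eqP; apply: contraT => ht; case: hn; exists t.
  rewrite !hornerM !mulf_eq0 !negb_or => /andP[/andP[h1 h2] h3].
  by have [] := count w0 t Xi0 h1 h2 h3.
have R0 : R != 0 by apply: contraNneq psi0 => ->; rewrite rmorph0.
have [N hR] := resultant_formcoef (weighted_toY3 hG) (weighted_toY3u hZ).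
have [c [h [n [hc RE hh hprim]]]] := content_exists R0 hR.
have h0 : h != 0 by apply: contraNneq R0 => h0; rewrite RE h0 scaler0.
have dc0 : deh c != 0.
  by apply: contraNneq psi0 => e; rewrite RE psiZ e mul0r.
set bad := c1 * c2 * lead_coef f * deh c.
have bad0 : bad != 0 by rewrite !mulf_neq0.
set bs := roots_of bad.
have good t : t \notin bs ->
  [/\ c1.[t] != 0, c2.[t] != 0, (lead_coef f).[t] != 0 & (deh c).[t] != 0].
  rewrite mem_roots_of // /root !hornerM !mulf_eq0 !negb_or.
  by move=> /andP[/andP[/andP[]]].
pose ls : seq (C * C) := (0, 1) :: [seq (1, t) | t <- bs].
have lsP l : l \in ls -> l = (0, 1) \/ exists2 t, t \in bs & l = (1, t).
  by rewrite in_cons => /orP[/eqP ->|/mapP [t tb ->]]; [left|right; exists t].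
have ls0 l : l \in ls -> (l.1 != 0) || (l.2 != 0).
  by move=> /lsP [->|[t _ ->]]; rewrite /= oner_neq0 ?orbT.
have [|q1 q10 hq1] := @generic_all _ ls
  (fun l w => evA (vec2 l.1 l.2) w h != 0).
  move=> l /ls0 /hprim [m hm]; exists (map_mpoly (meval (vec2 l.1 l.2)) h).
    exact: map_meval_neq0 hm.
  by move=> w; rewrite /evA mmap_meval_map.
have fib0 l : l \in ls -> fiber G l.1 l.2 != 0.
  move=> /ls0 l0; apply/eqP => F0.
  apply: (homogenize_line_neq0 Hg_irr Hg_deg l0) => s.
  by rewrite -fiber_horner F0 horner0.
(* No bad line lies inside the curve, so these points are finitely many, and (4) gives each one
   outside GG a nonvanishing coefficient of [Z]. The centre (0:0:1) is not of this form; (5) takes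
   care of it. *)
pose pts := [seq (l, s) | l <- ls, s <- roots_of (fiber G l.1 l.2)].
have ptsP l s : l \in ls -> G.@[vec3 l.1 l.2 s] = 0 -> (l, s) \in pts.
  move=> hl hs; apply/allpairsPdep; exists l, s; split=> //.
  by rewrite mem_roots_of ?fib0 // /root fiber_horner hs.
have [|q2 q20 hq2] := @generic_all _ pts (fun x w =>
    ~ inGG (vec3 x.1.1 x.1.2 x.2) ->
    ~ on_curve (specialize Z w) (vec3 x.1.1 x.1.2 x.2)).
  move=> x /allpairsPdep [l [s [hl hs ->]]] /=; set p := vec3 _ _ _.
  have [inp|ninp] := classic (inGG p); first by exists 1; rewrite ?oner_neq0.
  have gp : on_curve G p.
    by move: hs; rewrite mem_roots_of ?fib0 // => /rootP; rewrite fiber_horner.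
  have np : normalized p.
    by rewrite /p; case: (lsP l hl) => [->|[t _ ->]];
      [exact: normalized_vec3_01|exact: normalized_vec3_1].
  have [m hm] : exists m, (Z@_m).@[p] != 0.
    apply: NNPP => hn; apply: ninp; apply: H4 => // m.
    by apply/eqP; apply: contraT => hm; case: hn; exists m.
  exists (map_mpoly (meval p) Z); first exact: map_meval_neq0 hm.
  by move=> w /eqP qw _; rewrite /on_curve specialize_meval.
have [zo ne] := zopen_setI HXi_open HXi_ne (mulf_neq0 q10 q20).
exists (fun w => Xi w /\ (q1 * q2).@[w] != 0).
split; first exact: zo.
split; first exact: ne.
split; first by move=> w [].
exists n; split.
  by exists c, h; split; [exact: hc|split; [exact: RE|exact: ydeg_form h0 hh]].
move=> w [Xiw]; rewrite mevalM mulf_eq0 negb_or => /andP[/hq1 Hl /hq2 Hp].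
set z := aff (specialize Z w).
set hw := psi w h; set rs := roots_of hw.
have top : hw`_n != 0.
  by rewrite (psi_form_top w hh); apply: (Hl (0, 1)); rewrite mem_head.
have szh : size hw = n.+1.
  apply/eqP; rewrite eqn_leq psi_form_size // ltnNge; apply: contra top => le.
  by rewrite nth_default.
have hw0 : hw != 0 by rewrite -size_poly_eq0 szh.
have szrs : size rs = n by rewrite size_roots_of // szh.
have rs_good t : t \in rs -> t \notin bs.
  rewrite mem_roots_of // /root psi_horner; apply: contraTN => tb.
  by apply: (Hl (1, t)); rewrite in_cons map_f ?orbT.
pose ss t := [seq s <- roots_of (spec t f) | z.[s%:P].[t] == 0].
(* The content has no zero at a good [t], so the multiplicity of [t] in the specialized resultant is
   its multiplicity in [hw]. *)
have ssE t : t \notin bs -> uniq (ss t) /\ size (ss t) = count_mem t rs.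
  move=> /good [h1 h2 h3 h4]; have [_ us mu] := count w t Xiw h1 h2 h3.
  split; first by rewrite filter_uniq.
  by rewrite -[LHS]mu RE psiZ mupMr // mup_roots_of.
have ssP t s : (s \in ss t) = (G.@[vec3 1 t s] == 0) && ((specialize Z w).@[vec3 1 t s] == 0).
  rewrite mem_filter mem_roots_of ?(spec_aff_neq0 Hg_irr Hg_deg) // /root.
  by rewrite spec_horner !aff_horner hornerC andbC.
pose pl := [seq (t, s) | t <- undup rs, s <- ss t].
have szpl : size pl = n.
  rewrite size_allpairs_dep sumnE big_map -szrs -sum_count_undup.
  apply: eq_big_seq => t; rewrite mem_undup => /rs_good /ssE [_ e]; exact: e.
have upl : uniq pl.
  apply: allpairs_uniq_dep; first exact: undup_uniq.
    by move=> t; rewrite mem_undup => /rs_good /ssE [].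
  by move=> [t s] [t' s'] _ _ /= [-> ->].
have plP x : x \in pl -> [/\ x.1 \in rs & x.2 \in ss x.1].
  by move=> /allpairsPdep [t [s [ht hs ->]]]; split=> //; rewrite -mem_undup.
exists (fun k : 'I_n => vec3 1 (nth (0, 0) pl k).1 (nth (0, 0) pl k).2).
split.
  move=> i j e; have [_ e1 e2] := vec3_inj e; apply: ord_inj; apply/eqP.
  rewrite -(nth_uniq (0, 0) _ _ upl) ?szpl //; apply/eqP.
  by rewrite [LHS]surjective_pairing e1 e2 -surjective_pairing.
split.
  move=> k; have [|ht hs] := plP (nth (0, 0) pl k); first by rewrite mem_nth // szpl.
  move: hs; rewrite ssP => /andP[/eqP gp /eqP zp].
  split; first exact: normalized_vec3_1.
  split; first exact: zp.
  split; first exact: gp.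
  by have [_ /eqP h2 _ _] := good _ (rs_good _ ht); move/GGbad.
move=> p [np [zp [gp ninp]]].
have [[t [s pE]]|[s pE]|pE] := normalizedP np; rewrite pE in zp gp ninp *.
- have tb : t \notin bs.
    apply/negP => tb; have hl : (1, t) \in ls by rewrite in_cons map_f ?orbT.
    exact: (Hp _ (ptsP (1, t) s hl gp) ninp zp).
  have hs : s \in ss t by rewrite ssP; apply/andP; split; apply/eqP.
  (* A common point on a good line makes the multiplicity of that line positive, so [t] is a root of
     [hw]. *)
  have ht : t \in rs.
    have [_ e] := ssE t tb; rewrite -has_pred1 has_count -e.
    by case: (ss t) hs.
  have hx : (t, s) \in pl by apply/allpairsPdep; exists t, s; rewrite mem_undup.
  have lt : (index (t, s) pl < n)%N by rewrite -szpl index_mem.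
  by exists (Ordinal lt); rewrite /= nth_index.
- have hl : (0, 1) \in ls by rewrite mem_head.
  by case: (Hp _ (ptsP (0, 1) s hl gp) ninp zp).
- by have [_ [_ [_ [_ H5]]]] := H w Xiw; case: H5.
Qed.
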